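(* Let $F$ and $G$ be experiments on the state space $\Theta=\{\theta_0,\ldots,\theta_n\}$. The following are equivalent: (i) $F\succeq_{\textup{LB}}G$; (ii) $\overline{V}_F(\boldsymbol{q})\ge\overline{V}_G(\boldsymbol{q})$ for every QCC decision problem and every $\boldsymbol{q}\in\widehat{\Delta}_n$; (iii) for every QCC decision problem $\{\mathcal{A},u\}$ and every strategy $\sigma_G$ under $G$, there exists a strategy $\sigma_F$ under $F$ with $u(\sigma_F,\theta)\ge u(\sigma_G,\theta)$ for each $\theta\in\Theta$.
   Context: States: $\Theta=\{\theta_0,\ldots,\theta_n\}\subset\mathbb{R}$. An experiment $F$ specifies, for each $\theta$, an absolutely continuous distribution $F(\cdot\mid\theta)$ with density $f(\cdot\mid\theta)$ of a signal in a compact interval $\mathcal{X}$; likewise $G$ with densities $g(\cdot\mid\theta)$ on a compact interval $\mathcal{Y}$. $\widehat{\Delta}_n=\{\boldsymbol{q}\in[0,1]^n:\sum_iq_i\le1\}$; a belief $\boldsymbol{p}\in\widehat{\Delta}_n$ puts mass $p_i$ on $\theta_i$ ($i\ge1$) and $p_0=1-\sum_ip_i$ on $\theta_0$. Posterior $p_{F,i}(x;\boldsymbol{q})=q_if(x\mid\theta_i)/\sum_jq_jf(x\mid\theta_j)$; $\boldsymbol{p}_F(\boldsymbol{q})=(p_{F,1},\ldots,p_{F,n})(X;\boldsymbol{q})$ with $X\sim\sum_jq_jF(\cdot\mid\theta_j)$ (analogously for $G$). $F\succeq_{\textup{LB}}G$ means: for every $\boldsymbol{q}\in\widehat{\Delta}_n$,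 $\boldsymbol{b}\in\mathbb{R}^n$ and convex $C:\mathbb{R}\to\mathbb{R}$, $\mathbb{E}[C(\boldsymbol{b}\cdot\boldsymbol{p}_F(\boldsymbol{q}))]\ge\mathbb{E}[C(\boldsymbol{b}\cdot\boldsymbol{p}_G(\boldsymbol{q}))]$. A decision problem $\{\mathcal{A},u\}$ here has $\mathcal{A}\subset\mathbb{R}$ and $u:\mathcal{A}\times\Theta\to\mathbb{R}$, where either $\mathcal{A}$ is finite, or $\mathcal{A}$ is a compact interval and $u(a,\theta)$ is differentiable in $a$ for every $\theta$. Let $u(a,\boldsymbol{p})=\sum_{i=0}^np_iu(a,\theta_i)$; the problem is quasi-concave (QCC) if $a\mapsto u(a,\boldsymbol{p})$ is quasi-concave on $\mathcal{A}$ for every $\boldsymbol{p}\in\widehat{\Delta}_n$. $V(\boldsymbol{p})=\max_{a\in\mathcal{A}}u(a,\boldsymbol{p})$, $\overline{V}_F(\boldsymbol{q})=\mathbb{E}[V(\boldsymbol{p}_F(\boldsymbol{q}))]$. A strategy under $F$ is a measurable $\sigma_F:\mathcal{X}\to\Delta(\mathcal{A})$ with $u(\sigma_F,\theta)=\int_{\mathcal{X}}\int_{\mathcal{A}}u(a,\theta)\,\sigma_F(x)(da)\,dF(x\mid\theta)$; analogously for $G$. *)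

(* Defs.v *)
From HB Require Import structures.
From mathcomp Require Import all_boot all_order all_algebra.
From mathcomp Require Import all_classical all_reals all_analysis.
Set Implicit Arguments.
Unset Strict Implicit.
Unset Printing Implicit Defensive.
Import Order.TTheory GRing.Theory Num.Theory.
Import numFieldNormedType.Exports.
Local Open Scope classical_set_scope.
Local Open Scope ring_scope.

(* States theta_0,...,theta_n are indexed by 'I_n.+1 (theta_i <-> i).
   A belief q in hat-Delta_n is a vector q : 'I_n -> R, where q i is the
   mass of theta_{i+1}; the mass of theta_0 is 1 - sum_i q i. *)

Definition in_hsimplex (R : realType) (n : nat) (q : 'I_n -> R) : Prop :=
  (forall i, 0 <= q i) /\ \sum_(i < n) q i <= 1.

Definition fullb (R : realType) (n : nat) (q : 'I_n -> R) : 'I_n.+1 -> R :=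
  fun j => if unlift ord0 j is Some i then q i else 1 - \sum_(i < n) q i.

(* An experiment on the compact interval [lo, hi]: for each state a density
   (measurable, nonnegative, integrating to 1 on [lo, hi]) of an absolutely
   continuous distribution of the signal. *)
Definition is_experiment (R : realType) (n : nat) (lo hi : R)
    (f : 'I_n.+1 -> R -> R) : Prop :=
  lo <= hi /\
  forall i, [/\ measurable_fun `[lo, hi]%classic (f i),
                (forall x, `[lo, hi]%classic x -> 0 <= f i x) &
                (\int[lebesgue_measure]_(x in `[lo, hi]%classic) (f i x)%:E = 1)%E].

Definition mixdens (R : realType) (n : nat) (f : 'I_n.+1 -> R -> R)
    (q : 'I_n -> R) (x : R) : R :=
  \sum_(j < n.+1) fullb q j * f j x.

Definition posterior (R : realType) (n : nat) (f : 'I_n.+1 -> R -> R)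
    (q : 'I_n -> R) (x : R) : 'I_n -> R :=
  fun i => q i * f (lift ord0 i) x / mixdens f q x.

Definition post_expect (R : realType) (n : nat) (lo hi : R)
    (f : 'I_n.+1 -> R -> R) (q : 'I_n -> R) (h : ('I_n -> R) -> R) : \bar R :=
  (\int[lebesgue_measure]_(x in `[lo, hi]%classic) (mixdens f q x * h (posterior f q x))%:E)%E.

Definition LB_dominates (R : realType) (n : nat) (xl xr : R) (f : 'I_n.+1 -> R -> R)
    (yl yr : R) (g : 'I_n.+1 -> R -> R) : Prop :=
  forall (q : 'I_n -> R), in_hsimplex q ->
  forall (b : 'I_n -> R) (C : R -> R), @convex_function R R^o setT C ->
  (post_expect yl yr g q (fun p => (C (\sum_(i < n) b i * p i))%R)
   <= post_expect xl xr f q (fun p => (C (\sum_(i < n) b i * p i))%R))%E.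

Definition decision_problem (R : realType) (n : nat) (A : set R)
    (u : R -> 'I_n.+1 -> R) : Prop :=
  (finite_set A /\ A !=set0) \/
  (exists al ar : R, [/\ al <= ar, A = `[al, ar]%classic &
     forall i a, `[al, ar]%classic a -> derivable (fun a' => u a' i) a 1]).

Definition ubel (R : realType) (n : nat) (u : R -> 'I_n.+1 -> R)
    (a : R) (p : 'I_n -> R) : R :=
  \sum_(j < n.+1) fullb p j * u a j.

Definition quasi_concave_on (R : realType) (A : set R) (g : R -> R) : Prop :=
  forall a b c, A a -> A b -> A c -> a <= b -> b <= c ->
    Num.min (g a) (g c) <= g b.

Definition QCC (R : realType) (n : nat) (A : set R) (u : R -> 'I_n.+1 -> R) : Prop :=
  forall p : 'I_n -> R, in_hsimplex p -> quasi_concave_on A (fun a => ubel u a p).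

Definition Vval (R : realType) (n : nat) (A : set R) (u : R -> 'I_n.+1 -> R)
    (p : 'I_n -> R) : R :=
  sup [set ubel u a p | a in A].

Definition Vbar (R : realType) (n : nat) (lo hi : R) (f : 'I_n.+1 -> R -> R)
    (A : set R) (u : R -> 'I_n.+1 -> R) (q : 'I_n -> R) : \bar R :=
  post_expect lo hi f q (Vval A u).

(* A strategy under an experiment on [lo, hi]: a measurable map x |-> sigma x
   in Delta(A), represented by a probability kernel from R to R whose
   measures are concentrated on A at every signal x in [lo, hi]. *)
Definition is_strategy (R : realType) (lo hi : R) (A : set R)
    (sigma : R.-pker R ~> R) : Prop :=
  forall x, `[lo, hi]%classic x -> sigma x A = 1%E.

Definition strat_payoff (R : realType) (n : nat) (lo hi : R) (f : 'I_n.+1 -> R -> R)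
    (A : set R) (u : R -> 'I_n.+1 -> R) (sigma : R.-pker R ~> R) (i : 'I_n.+1)
    : \bar R :=
  (\int[lebesgue_measure]_(x in `[lo, hi]%classic)
     ((\int[sigma x]_(a in A) (u a i)%:E) * (f i x)%:E))%E.

(* Main.v *)
(* All three conditions are equivalent to the zonoid order
   [\int max(sum_i c_i g_i, 0) <= \int max(sum_i c_i f_i, 0)] for every [c].
   It follows from each of them by testing a two-action problem, or
   [C t = max(t + k, 0)], at the uniform prior.

   Conversely, in a finite QCC problem with actions [a_0 < ... < a_m] the
   increments of [u(., p)] change sign at most once, so
   [V p = u(a_0, p) + sum_k max(u(a_(k+1), p) - u(a_k, p), 0)], whose expectation
   is monotone in the zonoid order. Interval problems are uniform limits of
   finite ones, and a convex function of [b . p] is a uniform limit of values of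
   the problems whose actions are its tangent lines, which are QCC; this gives
   (ii) and (i).

   For (iii), the comparison of values shows that no prior separates the payoff
   vector of [sigma_G] from the convex set of payoff vectors under [F], so it can
   be approached within any [e > 0]. Taking nearly feasible strategies of nearly
   minimal L^2 norm yields a sequence converging almost everywhere, which replaces
   weak compactness. When [A] is finite these are mixed strategies. When [A] is an
   interval, QCC makes every mixture of two actions dominated by a pure action in
   all states simultaneously, so payoff profiles dominated by pure strategies
   already form a convex set, and the limit superior of the pure strategies
   dominates the limit profile. *)
Require Import Defs.
From HB Require Import structures.
From mathcomp Require Import all_boot all_order all_algebra finmap.
From mathcomp Require Import all_classical all_reals all_analysis measurable_realfun.
From mathcomp Require Import ring lra.
Set Implicit Arguments.
Unset Strict Implicit.
Unset Printing Implicit Defensive.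
Import Order.TTheory GRing.Theory Num.Theory.
Import numFieldNormedType.Exports.
Local Open Scope classical_set_scope.
Local Open Scope ring_scope.

(** * Beliefs and posteriors *)

Section beliefs.
Context {R : realType} {n : nat}.
Implicit Types (q : 'I_n -> R) (c w : 'I_n.+1 -> R) (A : set R)
  (u : R -> 'I_n.+1 -> R).

Definition simplex c := (forall i, 0 <= c i) /\ \sum_i c i = 1.

(** Expected utility against unnormalized weights. With [c i = fullb q i * f i x] it replaces a
    posterior expectation without dividing by the density of the signal. *)
Definition score u c (a : R) : R := \sum_i c i * u a i.

Lemma fullb0 q : fullb q ord0 = 1 - \sum_i q i.
Proof. by rewrite /fullb unlift_none. Qed.

Lemma fullb_lift q i : fullb q (lift ord0 i) = q i.
Proof. by rewrite /fullb liftK. Qed.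

Lemma fullb_simplex q : in_hsimplex q -> simplex (fullb q).
Proof.
move=> [q0 q1]; split.
  move=> i; case: (unliftP ord0 i) => [j|] ->.
    by rewrite fullb_lift.
  by rewrite fullb0 subr_ge0.
rewrite big_ord_recl fullb0.
by under [X in _ + X]eq_bigr do rewrite fullb_lift; rewrite subrK.
Qed.

Lemma fullb_behead c : \sum_i c i = 1 -> fullb (fun i => c (lift ord0 i)) = c.
Proof.
move=> c1; apply/funext => i; case: (unliftP ord0 i) => [j|] ->.
  by rewrite fullb_lift.
by rewrite fullb0 -c1 big_ord_recl addrK.
Qed.

Lemma simplex_behead c : simplex c -> in_hsimplex (fun i => c (lift ord0 i)).
Proof.
move=> [c0 c1]; split=> [i|]; first exact: c0.
by rewrite -c1 big_ord_recl lerDr.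
Qed.

Lemma score_scale u c a (k : R) : score u (fun i => k * c i) a = k * score u c a.
Proof. by rewrite /score big_distrr /=; apply: eq_bigr => i _; rewrite mulrA. Qed.

(** Quasi-concavity survives scaling by a positive constant, so weights of positive mass are
    normalized to a belief; weights of mass zero give a zero score. *)
Lemma score_qc A u c : QCC A u -> (forall i, 0 <= c i) ->
  quasi_concave_on A (score u c).
Proof.
move=> qcc c0 a b d Aa Ab Ad ab bd.
have m0 : 0 <= \sum_i c i by apply: sumr_ge0.
have [m00|mn0] := eqVneq (\sum_i c i) 0.
  have ci i : c i = 0.
    apply/eqP; move/eqP : m00; rewrite psumr_eq0// => /allP/(_ i).
    by rewrite mem_index_enum => /(_ isT).
  by rewrite /score !big1 ?minxx// => i _; rewrite ci mul0r.
pose m := \sum_i c i.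
have mgt0 : 0 < m by rewrite lt_neqAle eq_sym mn0.
pose c' i := m^-1 * c i.
have sc' : simplex c'.
  split; first by move=> i; rewrite mulr_ge0// invr_ge0.
  by rewrite -big_distrr /= mulVf.
have := qcc _ (simplex_behead sc') a b d Aa Ab Ad ab bd.
rewrite /ubel (fullb_behead (proj2 sc')) -!/(score u c' _) !score_scale.
by rewrite -minr_pMr ?invr_ge0// ler_pM2l// invr_gt0.
Qed.

(** Bayes' rule for every state. State 0 receives its mass as a complement in [fullb], so its case
    rests on the normalized weights [w] summing to one. *)
Lemma posterior_fullb (f : 'I_n.+1 -> R -> R) q x : mixdens f q x != 0 ->
  forall j, mixdens f q x * fullb (posterior f q x) j = fullb q j * f j x.
Proof.
move=> m0 j.
set w := fun j => (mixdens f q x)^-1 * (fullb q j * f j x).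
have w1 : \sum_j w j = 1 by rewrite -big_distrr /= mulVf.
have -> : posterior f q x = (fun i => w (lift ord0 i)).
  by apply/funext => i; rewrite /posterior /w fullb_lift mulrC.
by rewrite (fullb_behead w1) mulrA mulfV// mul1r.
Qed.

Lemma mixdens_ge0 (f : 'I_n.+1 -> R -> R) q x : in_hsimplex q ->
  (forall i, 0 <= f i x) -> 0 <= mixdens f q x.
Proof.
move=> /fullb_simplex[q0 _] f0; apply: sumr_ge0 => i _.
by rewrite mulr_ge0.
Qed.

Lemma mixdens0 (f : 'I_n.+1 -> R -> R) q x : in_hsimplex q ->
  (forall i, 0 <= f i x) -> mixdens f q x = 0 ->
  forall j, fullb q j * f j x = 0.
Proof.
move=> /fullb_simplex[q0 _] f0 /eqP; rewrite psumr_eq0; last first.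
  by move=> i _; rewrite mulr_ge0.
by move=> /allP h j; apply/eqP/h; rewrite mem_index_enum.
Qed.

Lemma posterior_hsimplex (f : 'I_n.+1 -> R -> R) q x : in_hsimplex q ->
  (forall i, 0 <= f i x) -> mixdens f q x != 0 -> in_hsimplex (posterior f q x).
Proof.
move=> hq f0 m0.
set w := fun j => (mixdens f q x)^-1 * (fullb q j * f j x).
have w1 : \sum_j w j = 1 by rewrite -big_distrr /= mulVf.
have -> : posterior f q x = (fun i => w (lift ord0 i)).
  by apply/funext => i; rewrite /posterior /w fullb_lift mulrC.
apply: simplex_behead; split=> // i.
rewrite mulr_ge0 ?invr_ge0 ?mixdens_ge0// mulr_ge0//.
by case: (fullb_simplex hq).
Qed.

(** Where the signal density vanishes the posterior is a division by zero, but then every weight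
    [fullb q i * f i x] vanishes and both sides are zero. *)
Lemma mixdens_ubel u (f : 'I_n.+1 -> R -> R) q x a : in_hsimplex q ->
  (forall i, 0 <= f i x) ->
  mixdens f q x * ubel u a (posterior f q x) =
  score u (fun i => fullb q i * f i x) a.
Proof.
move=> hq f0; have [m0|m0] := eqVneq (mixdens f q x) 0.
  by rewrite m0 mul0r /score big1// => i _; rewrite mixdens0// mul0r.
rewrite /ubel /score big_distrr /=; apply: eq_bigr => i _.
by rewrite mulrA posterior_fullb.
Qed.

End beliefs.

(** * Integration against densities *)

Section integration.
Context d (T : measurableType d) (R : realType) (mu : {measure set T -> \bar R}).
Implicit Types (f h : T -> R).

Definition is_density f := [/\ measurable_fun setT f, (forall x, 0 <= f x) &
  (\int[mu]_x (f x)%:E = 1)%E].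

Definition bounded_measurable h :=
  measurable_fun setT h /\ exists M, forall x, `|h x| <= M.

Local Notation integrable h := (mu.-integrable setT (EFin \o h)).

Lemma integrableD_EFin h1 h2 : integrable h1 -> integrable h2 ->
  integrable (fun x => h1 x + h2 x).
Proof.
move=> i1 i2; have := integrableD measurableT i1 i2.
by apply: eq_integrable.
Qed.

Lemma integrableB_EFin h1 h2 : integrable h1 -> integrable h2 ->
  integrable (fun x => h1 x - h2 x).
Proof.
move=> i1 i2; have := integrableB measurableT i1 i2.
by apply: eq_integrable.
Qed.

Lemma integrableZl_EFin k h : integrable h -> integrable (fun x => k * h x).
Proof.
move=> i1; have := integrableZl measurableT k i1.
by apply: eq_integrable.
Qed.

Lemma integrable_sum_EFin I (s : seq I) (h : I -> T -> R) :
  (forall i, integrable (h i)) -> integrable (fun x => \sum_(i <- s) h i x).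
Proof.
move=> ih; elim: s => [|i s ih'].
  by under eq_fun do rewrite big_nil; exact: integrable0.
rewrite /comp; under eq_fun do rewrite big_cons.
exact: integrableD_EFin.
Qed.

Lemma le_integrable_EFin h1 h2 : measurable_fun setT h1 ->
  (forall x, `|h1 x| <= h2 x) -> integrable h2 -> integrable h1.
Proof.
move=> m1 h12; apply: le_integrable => //; first exact/measurable_EFinP.
by move=> x _ /=; rewrite lee_fin (le_trans (h12 x))// ler_norm.
Qed.

Lemma integrable_measurable h : integrable h -> measurable_fun setT h.
Proof. by move=> /measurable_int/measurable_EFinP. Qed.

Lemma integrable_max h1 h2 : integrable h1 -> integrable h2 ->
  integrable (fun x => Num.max (h1 x) (h2 x)).
Proof.
move=> i1 i2.
apply: (@le_integrable_EFin _ (fun x => `|h1 x| + `|h2 x|)).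
- exact: measurable_maxr (integrable_measurable i1) (integrable_measurable i2).
- move=> x; rewrite /Num.max; case: ifP => _.
    by rewrite lerDr.
  by rewrite lerDl.
- by apply: integrableD_EFin; exact: integrable_norm.
Qed.

Lemma Rintegral_sum I (s : seq I) (h : I -> T -> R) :
  (forall i, integrable (h i)) ->
  \int[mu]_x (\sum_(i <- s) h i x) = \sum_(i <- s) \int[mu]_x h i x.
Proof.
move=> ih; elim: s => [|i s ih'].
  rewrite big_nil; under eq_Rintegral do rewrite big_nil.
  by rewrite /Rintegral integral0.
under eq_Rintegral do rewrite big_cons.
rewrite RintegralD// ?ih' ?big_cons//.
exact: integrable_sum_EFin.
Qed.

Lemma integral_Rintegral h : integrable h ->
  (\int[mu]_x (h x)%:E = (\int[mu]_x h x)%:E)%E.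
Proof. by move=> ih; rewrite fineK//; exact: integrable_fin_num. Qed.

Lemma is_density_integrable f : is_density f -> integrable f.
Proof.
move=> [mf f0 f1]; apply/integrableP; split; first exact/measurable_EFinP.
under eq_integral do rewrite /= ger0_norm//.
by rewrite f1 ltry.
Qed.

Lemma Rintegral_density f : is_density f -> \int[mu]_x f x = 1.
Proof. by move=> [_ _ f1]; rewrite /Rintegral f1. Qed.

Lemma bounded_measurable_integrable f h : is_density f -> bounded_measurable h ->
  integrable (fun x => h x * f x).
Proof.
move=> df [mh [M hM]]; have [mf f0 _] := df.
apply: (@le_integrable_EFin _ (fun x => M * f x)).
- exact: measurable_funM.
- by move=> x; rewrite normrM (ger0_norm (f0 x)) ler_wpM2r.
- exact/integrableZl_EFin/is_density_integrable.
Qed.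

Lemma bounded_measurable_cst k : bounded_measurable (fun=> k).
Proof. by split; [exact: measurable_cst|exists `|k|]. Qed.

Lemma bounded_measurableD h1 h2 : bounded_measurable h1 ->
  bounded_measurable h2 -> bounded_measurable (fun x => h1 x + h2 x).
Proof.
move=> [m1 [M1 h1M]] [m2 [M2 h2M]]; split; first exact: measurable_funD.
by exists (M1 + M2) => x; rewrite (le_trans (ler_normD _ _))// lerD.
Qed.

Lemma bounded_measurableM h1 h2 : bounded_measurable h1 ->
  bounded_measurable h2 -> bounded_measurable (fun x => h1 x * h2 x).
Proof.
move=> [m1 [M1 h1M]] [m2 [M2 h2M]]; split; first exact: measurable_funM.
by exists (M1 * M2) => x; rewrite normrM ler_pM.
Qed.

Lemma bounded_measurable_sum I (s : seq I) (h : I -> T -> R) :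
  (forall i, bounded_measurable (h i)) ->
  bounded_measurable (fun x => \sum_(i <- s) h i x).
Proof.
move=> ih; elim: s => [|i s ih'].
  by under eq_fun do rewrite big_nil; exact: bounded_measurable_cst.
under eq_fun do rewrite big_cons.
exact: bounded_measurableD.
Qed.

(** Every function on the discrete space [nat] is measurable. Strategies with countably many actions
    are written in this form. *)
Lemma bounded_measurable_comp (k : nat -> R) (j : T -> nat) (M : R) :
  measurable_fun setT j -> (forall n, `|k n| <= M) ->
  bounded_measurable (fun x => k (j x)).
Proof.
move=> mj kM; split; last by exists M.
by apply: (@measurableT_comp _ _ _ _ _ _ k _ j).
Qed.
End integration.

(** * The value of a finite quasi-concave problem *)

Section finite_value.
Context {R : realType} {n : nat}.
Implicit Types (u : R -> 'I_n.+1 -> R) (phi : R -> R).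

Fixpoint maxs phi a s : R :=
  if s is b :: s' then Num.max (phi a) (maxs phi b s') else phi a.

Lemma maxs_ge phi a s b : b \in a :: s -> phi b <= maxs phi a s.
Proof.
elim: s a => [|c s ih] a /=; first by rewrite inE => /eqP ->.
rewrite in_cons le_max => /orP[/eqP ->|/ih ->]; first by rewrite lexx.
by rewrite orbT.
Qed.

Lemma maxs_mem phi a s : exists2 b, b \in a :: s & maxs phi a s = phi b.
Proof.
elim: s a => [|c s ih] a /=; first by exists a => //; rewrite inE.
have [b bs ->] := ih c; rewrite /Num.max; case: ifP => _.
  by exists b => //; rewrite in_cons bs orbT.
by exists a => //; rewrite in_cons eqxx.
Qed.

(* Under quasi-concavity the value increases by a positive part when an action
   below all the others becomes available; iterating, the value function of a
   QCC problem is a linear function plus positive parts of linear functions. *)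
Lemma maxs_cons_qc phi a b s : path <=%R a (b :: s) ->
  quasi_concave_on [set` a :: b :: s] phi ->
  maxs phi a (b :: s) = maxs phi b s + Num.max (phi a - phi b) 0.
Proof.
move=> /= /andP[ab bs] qc; have [pab|pba] := leP (phi a) (phi b).
  rewrite [X in _ + X](max_idPr _); last by rewrite subr_le0.
  rewrite addr0; apply/max_idPr; apply: (le_trans pab).
  by apply: maxs_ge; rewrite in_cons eqxx.
rewrite [X in _ + X](max_idPl _); last by rewrite subr_ge0 ltW.
(* As [phi b < phi a], a later [c] with [phi b < phi c] would create a strict dip at [b] between [a]
   and [c]. *)
have -> : maxs phi b s = phi b.
  apply/eqP; rewrite eq_le maxs_ge ?in_cons ?eqxx// andbT.
  have [c cs ->] := maxs_mem phi b s.
  have /= := qc a b c; rewrite !in_cons !eqxx orbT /= => /(_ isT isT).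
  rewrite -in_cons cs orbT => /(_ isT ab).
  have -> : b <= c.
    move: cs; rewrite in_cons => /orP[/eqP ->//|].
    by move: bs => /(order_path_min le_trans)/allP; apply.
  by move=> /(_ isT); rewrite ge_min leNgt pba.
by rewrite (max_idPl (ltW pba)) addrC subrK.
Qed.

Context d (T : measurableType d) (mu : {measure set T -> \bar R}).
Implicit Types (f g : 'I_n.+1 -> T -> R).

(* The two sides are the support functions of the zonoids
   [{(\int phi g_i)_i | 0 <= phi <= 1}] and [{(\int phi f_i)_i | 0 <= phi <= 1}]. *)
Definition zonoid_le g f := forall c : 'I_n.+1 -> R,
  \int[mu]_x Num.max (\sum_i c i * g i x) 0 <=
  \int[mu]_x Num.max (\sum_i c i * f i x) 0.

Local Notation integrable h := (mu.-integrable setT (EFin \o h)).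

Lemma integrable_score u f (c : 'I_n.+1 -> R) a : (forall i, is_density mu (f i)) ->
  integrable (fun x => score u (fun i => c i * f i x) a).
Proof.
move=> df; apply: integrable_sum_EFin => i.
under eq_fun do rewrite mulrAC; apply: integrableZl_EFin.
exact: is_density_integrable.
Qed.

Lemma Rintegral_score u f c a : (forall i, is_density mu (f i)) ->
  \int[mu]_x score u (fun i => c i * f i x) a = score u c a.
Proof.
move=> df; rewrite /score Rintegral_sum; last first.
  move=> i; under eq_fun do rewrite mulrAC; apply: integrableZl_EFin.
  exact: is_density_integrable.
apply: eq_bigr => i _; under eq_Rintegral do rewrite mulrAC.
rewrite RintegralZl ?Rintegral_density ?mulr1//.
exact: is_density_integrable.
Qed.

Lemma integrable_maxs u f (c : 'I_n.+1 -> R) a s :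
  (forall i, is_density mu (f i)) ->
  integrable (fun x => maxs (score u (fun i => c i * f i x)) a s).
Proof.
move=> df; elim: s a => [|b s ih] a /=; first exact: integrable_score.
by apply: integrable_max => //; exact: integrable_score.
Qed.

(** Each action added below the others contributes the positive part of a linear form in the
    densities, which the zonoid order compares. With one action left both sides agree, since all
    densities integrate to one. *)
Lemma zonoid_le_maxs u f g c a s :
  (forall i, is_density mu (f i)) -> (forall i, is_density mu (g i)) ->
  zonoid_le g f -> path <=%R a s -> QCC [set` a :: s] u -> (forall i, 0 <= c i) ->
  \int[mu]_x maxs (score u (fun i => c i * g i x)) a s <=
  \int[mu]_x maxs (score u (fun i => c i * f i x)) a s.
Proof.
move=> df dg gf + + c0; elim: s a => [|b s ih] a pas qc.
  by rewrite !Rintegral_score.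
have E h : (forall i, is_density mu (h i)) ->
    \int[mu]_x maxs (score u (fun i => c i * h i x)) a (b :: s) =
    \int[mu]_x maxs (score u (fun i => c i * h i x)) b s +
    \int[mu]_x Num.max (\sum_i (c i * (u a i - u b i)) * h i x) 0.
  move=> dh; rewrite -RintegralD//; last 2 first.
    exact: integrable_maxs.
    apply: integrable_max; last exact: integrable0.
    apply: integrable_sum_EFin => i; apply: integrableZl_EFin.
    exact: is_density_integrable.
  apply: eq_Rintegral => x _; rewrite maxs_cons_qc//; last first.
    by apply: score_qc => // i; rewrite mulr_ge0//; case: (dh i).
  congr (_ + Num.max _ _); rewrite /score -sumrB; apply: eq_bigr => i _.
  by ring.
rewrite !E// lerD//; apply: ih; first by move: pas => /= /andP[].
move=> p hp x y z; rewrite /= => xs ys zs; apply: qc => //=.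
- by rewrite in_cons xs orbT.
- by rewrite in_cons ys orbT.
- by rewrite in_cons zs orbT.
Qed.
End finite_value.

(** * Attaining a payoff vector in a convex set of strategies *)

Section attain.
Context d (T : measurableType d) (R : realType) (mu : {measure set T -> \bar R}).
Variables (N m : nat) (f : 'I_N.+1 -> T -> R) (c : 'I_N.+1 -> 'I_m -> R).
Variables (V : (T -> 'I_m -> R) -> Prop) (M : R) (w : 'I_N.+1 -> R).
Hypothesis df : forall i, is_density mu (f i).
Hypothesis Vmeas : forall v, V v -> forall j, measurable_fun setT (v^~ j).
Hypothesis Vbnd : forall v, V v -> forall x j, `|v x j| <= M.
Hypothesis Vconv : forall v v' (t : R), V v -> V v' -> 0 <= t <= 1 ->
  V (fun x j => (1 - t) * v x j + t * v' x j).

(** The payoff is linear in [v] so that two cases share one argument: for a finite action set [v]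
    holds mixing probabilities and [c] utilities; for an interval [v] is a payoff profile and [c]
    the identity matrix. *)
Definition payoff v i := \int[mu]_x ((\sum_j c i j * v x j) * f i x).

Hypothesis Vopt : forall l, simplex l -> forall e : R, 0 < e ->
  exists2 v, V v & \sum_i l i * w i - e <= \sum_i l i * payoff v i.

Local Notation integrable h := (mu.-integrable setT (EFin \o h)).

Lemma bounded_measurable_coord v j : V v -> bounded_measurable (v^~ j).
Proof. by move=> Vv; split; [exact: Vmeas|exists M => x; exact: Vbnd]. Qed.

Lemma integrable_payoff v i : V v ->
  integrable (fun x => (\sum_j c i j * v x j) * f i x).
Proof.
move=> Vv; apply: bounded_measurable_integrable => //.
apply: bounded_measurable_sum => j; apply: bounded_measurableM.
  exact: bounded_measurable_cst.
exact: bounded_measurable_coord.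
Qed.

Lemma payoff_conv v v' t i : V v -> V v' ->
  payoff (fun x j => (1 - t) * v x j + t * v' x j) i =
  (1 - t) * payoff v i + t * payoff v' i.
Proof.
move=> Vv Vv'; rewrite /payoff -!RintegralZl//; try exact: integrable_payoff.
rewrite -RintegralD//; try exact/integrableZl_EFin/integrable_payoff.
apply: eq_Rintegral => x _; rewrite !mulrA -mulrDl; congr (_ * _).
rewrite !mulr_sumr -big_split /=; apply: eq_bigr => j _; ring.
Qed.

Definition payoff_bound := \sum_i \sum_j `|c i j| * M.

Lemma payoff_le v i : V v -> `|payoff v i| <= payoff_bound.
Proof.
move=> Vv.
apply: le_trans (le_normr_Rintegral measurableT (integrable_payoff i Vv)) _.
rewrite [leRHS](_ : _ = \int[mu]_x (payoff_bound * f i x)); last first.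
  by rewrite RintegralZl ?Rintegral_density ?mulr1//; exact: is_density_integrable.
apply: le_Rintegral => //.
- by have := integrable_norm (integrable_payoff i Vv).
- exact/integrableZl_EFin/is_density_integrable.
move=> x _; have M0 (j : 'I_m) : 0 <= M.
  exact: le_trans (normr_ge0 _) (Vbnd Vv x j).
have [_ f0 _] := df i; rewrite normrM (ger0_norm (f0 x)).
apply: ler_wpM2r => //; rewrite /payoff_bound (bigD1 i)//=.
apply: ler_wpDr.
  by apply: sumr_ge0 => k _; apply: sumr_ge0 => j _; rewrite mulr_ge0// M0.
apply: le_trans (ler_norm_sum _ _ _) _; apply: ler_sum => j _.
by rewrite normrM ler_wpM2l// Vbnd.
Qed.

Let gap v i := Num.max (w i - payoff v i) 0.
Let Phi v := \sum_i gap v i ^+ 2.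

(* Blackwell's approachability algorithm: moving a fraction 1/(k+1) of the way
   towards a strategy that is optimal for the weights [gap v] decreases the
   squared distance [Phi v] to the orthant above [w] at rate 1/k. *)
Lemma approachability : exists2 K, 0 <= K &
  forall k, exists2 v, V v & k.+1%:R ^+ 2 * Phi v <= k.+1%:R * K.
Proof.
pose B := payoff_bound.
pose K0 := \sum_(i < N.+1) (B + B) ^+ 2.
have gap0 v i : 0 <= gap v i by rewrite le_max lexx orbT.
have Phi0 v : 0 <= Phi v by apply: sumr_ge0 => i _; exact: sqr_ge0.
have [v0 Vv0] : exists v, V v.
  have [|v Vv _] := @Vopt (fun i => (i == ord0)%:R) _ 1 ltr01; last by exists v.
  split=> [i|]; first exact: ler0n.
  by rewrite (bigD1 ord0)//= big1 ?addr0// => i /negbTE ->.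
have K00 : 0 <= K0 by apply: sumr_ge0 => i _; exact: sqr_ge0.
(* [Phi v0 <= K] starts the induction; [K0 + 2 <= K] absorbs the error of one round, [2] for the
   tolerance of the reply and [K0] for the second-order term. *)
have [K [K_ge0 K_v0 K_K0]] : exists K : R, [/\ 0 <= K, Phi v0 <= K & K0 + 2 <= K].
  by exists (Phi v0 + K0 + 2); have := Phi0 v0; split; lra.
exists K => //.
elim=> [|k [v Vv ih]]; first by exists v0 => //; rewrite expr1n !mul1r.
pose L := \sum_i gap v i.
have L0 : 0 <= L by apply: sumr_ge0.
have [Lz|Lnz] := eqVneq L 0.
  exists v => //; rewrite /Phi big1; last first.
    move=> i _; move/eqP : Lz; rewrite psumr_eq0// => /allP/(_ i).
    by rewrite mem_index_enum => /(_ isT)/eqP ->; rewrite expr0n.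
  by rewrite mulr0 mulr_ge0.
have Lgt0 : 0 < L by rewrite lt_neqAle eq_sym Lnz.
pose t : R := k.+2%:R^-1.
have t0 : 0 < t by rewrite invr_gt0.
have t1 : t <= 1 by rewrite invf_le1// ler1n.
(* The weights are the gaps normalized by [L], so the tolerance [t / L] becomes [t] once [L] is
   multiplied back. *)
have [||v' Vv' v'P] := @Vopt (fun i => L^-1 * gap v i) _ (t / L).
- split=> [i|]; first by rewrite mulr_ge0// invr_ge0.
  by rewrite -mulr_sumr mulVf.
- by rewrite divr_gt0.
exists (fun x j => (1 - t) * v x j + t * v' x j).
  by apply: Vconv => //; rewrite ltW.
set P := Phi _.
have v'P' : - t <= \sum_i gap v i * (payoff v' i - w i).
  move: v'P; under eq_bigr do rewrite -mulrA.
  under [X in _ <= X]eq_bigr do rewrite -mulrA.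
  rewrite -!mulr_sumr => v'P.
  have : L * (L^-1 * (\sum_i gap v i * w i) - t / L) <=
         L * (L^-1 * \sum_i gap v i * payoff v' i) by rewrite ler_pM2l.
  rewrite mulrBr !mulrA mulfV// !mul1r [L * t]mulrC mulfK// => h.
  under eq_bigr do rewrite mulrBr.
  by rewrite sumrB; lra.
(* Coordinatewise expansion of the square. A coordinate already at its target opens a gap of at most
   [t * (a - b)], covered by the second-order term; elsewhere the positive part is bounded by the
   full square. *)
have PP : P <= Phi v - 2 * t * (\sum_i gap v i * (payoff v' i - w i) + Phi v)
    + t ^+ 2 * K0.
  rewrite /P /Phi /K0 -big_split /= !mulr_sumr -sumrB -big_split /=.
  apply: ler_sum => i _; rewrite /gap payoff_conv//.
  have := payoff_le i Vv; have := payoff_le i Vv'; rewrite -/B !ler_norml.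
  move: (payoff v i) (payoff v' i) (w i) => a b z.
  move=> /andP[b1 b2] /andP[a1 a2].
  have ab : (b - a) ^+ 2 <= (B + B) ^+ 2.
    by rewrite -ler_sqrt ?sqr_ge0// !sqrtr_sqr ler_norml ger0_norm; lra.
  have : t ^+ 2 * (b - a) ^+ 2 <= t ^+ 2 * (B + B) ^+ 2.
    by rewrite ler_wpM2l// sqr_ge0.
  have tab : 0 <= t ^+ 2 * (b - a) ^+ 2 by rewrite mulr_ge0 ?sqr_ge0.
  move: (t ^+ 2 * (B + B) ^+ 2) => D.
  have [za|za] := leP (z - a) 0.
    rewrite !expr0n /= => tD; set s := (_ - _ in leLHS).
    have [s0|s0] := leP s 0; first by rewrite expr0n/=; nra.
    have : s <= t * (a - b) by rewrite /s; lra.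
    by move=> sl; have : s ^+ 2 <= (t * (a - b)) ^+ 2; [rewrite lerXn2r// nnegrE; lra|nra].
  move=> tD; set s := (_ - _ in leLHS).
  have [s0|s0] := leP s 0.
    rewrite expr0n/=.
    apply: le_trans (_ : (z - a - t * (b - a)) ^+ 2 <= _); first exact: sqr_ge0.
    nra.
  by rewrite /s; nra.
have kt : k.+2%:R * t = 1 by rewrite mulfV.
have k2 : 1 <= k.+2%:R :> R by rewrite ler1n.
have e1 : k.+2%:R ^+ 2 * P <= (k.+2%:R ^+ 2 - 2 * k.+2%:R) * Phi v + 2 + K0.
  have h : k.+2%:R ^+ 2 * P <= k.+2%:R ^+ 2 * (Phi v -
      2 * t * (\sum_i gap v i * (payoff v' i - w i) + Phi v) + t ^+ 2 * K0).
    by rewrite ler_pM2l// exprn_gt0.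
  apply: (le_trans h).
  move: v'P'; set Z := \sum_i _ => v'P'.
  have : (k.+2%:R * t) * (k.+2%:R * (Z + t)) >= 0.
    by rewrite kt mul1r mulr_ge0//; lra.
  have -> : k.+2%:R ^+ 2 * (Phi v - 2 * t * (Z + Phi v) + t ^+ 2 * K0) =
     k.+2%:R ^+ 2 * Phi v - 2 * (k.+2%:R * t) * k.+2%:R * (Z + Phi v)
      + (k.+2%:R * t) ^+ 2 * K0 by ring.
  rewrite kt expr1n !mul1r mulr1 mulrDr kt.
  by move: (k.+2%:R : R) => k' hZ; lra.
apply: (le_trans e1).
have -> : (k.+2%:R ^+ 2 - 2 * k.+2%:R) * Phi v = k.+1%:R ^+ 2 * Phi v - Phi v.
  by rewrite -[k.+2%:R](natrD _ 1 k.+1); ring.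
have -> : k.+2%:R * K = k.+1%:R * K + K.
  by rewrite -[k.+2]addn1 natrD mulrDl mul1r.
have := Phi0 v; move: ih K_K0.
move: (k.+1%:R ^+ 2 * Phi v) (k.+1%:R * K) (Phi v) => a b p; lra.
Qed.

(** After enough rounds the squared distance [Phi v] is below [e ^+ 2], and it bounds each squared
    gap. *)
Lemma payoff_approx e : 0 < e ->
  exists2 v, V v & forall i, w i - e <= payoff v i.
Proof.
move=> e0; have [K _ HK] := approachability.
have [k Hk] : exists k, K / e ^+ 2 <= k.+1%:R.
  exists (Num.truncn (K / e ^+ 2)).
  by rewrite ltW// truncnS_gt// divr_ge0// sqr_ge0.
have [v Vv hv] := HK k; exists v => // i.
have k0 : 0 < k.+1%:R :> R by [].
have Ph : Phi v <= e ^+ 2.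
  move: hv; rewrite expr2 -mulrA ler_pM2l// => hv.
  move: Hk; rewrite ler_pdivrMr ?exprn_gt0// => Hk.
  by rewrite -(ler_pM2l k0) (le_trans hv).
have gi : gap v i ^+ 2 <= e ^+ 2.
  apply: le_trans Ph; rewrite /Phi (bigD1 i)//= lerDl.
  by apply: sumr_ge0 => j _; exact: sqr_ge0.
have g0 : 0 <= gap v i by rewrite le_max lexx orbT.
have : gap v i <= e by rewrite -ler_sqr// nnegrE ltW.
by rewrite /gap ge_max => /andP[h _]; lra.
Qed.
End attain.

(** * Nearly feasible strategies of nearly minimal norm *)

Section min_norm.
Context d (T : measurableType d) (R : realType) (mu : {measure set T -> \bar R}).
Variables (N m : nat) (f : 'I_N.+1 -> T -> R) (c : 'I_N.+1 -> 'I_m -> R).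
Variables (V : (T -> 'I_m -> R) -> Prop) (M : R) (w : 'I_N.+1 -> R).
Hypothesis df : forall i, is_density mu (f i).
Hypothesis Vmeas : forall v, V v -> forall j, measurable_fun setT (v^~ j).
Hypothesis Vbnd : forall v, V v -> forall x j, `|v x j| <= M.
Hypothesis Vconv : forall v v' (t : R), V v -> V v' -> 0 <= t <= 1 ->
  V (fun x j => (1 - t) * v x j + t * v' x j).

Local Notation payoff := (payoff mu f c).
Local Notation integrable h := (mu.-integrable setT (EFin \o h)).

Hypothesis Vapprox : forall e : R, 0 < e ->
  exists2 v, V v & forall i, w i - e <= payoff v i.

Let coord v j (Vv : V v) : bounded_measurable (v^~ j) :=
  bounded_measurable_coord Vmeas Vbnd j Vv.

(** The norm is taken against the laws [f i] and not against [mu]: bounded strategies then have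
    finite norm even when [mu] is infinite. *)
Definition sqnorm (v : T -> 'I_m -> R) := \sum_i \sum_j \int[mu]_x (v x j ^+ 2 * f i x).

Lemma integrable_sq (v : T -> 'I_m -> R) i j : bounded_measurable (v^~ j) ->
  integrable (fun x => v x j ^+ 2 * f i x).
Proof.
move=> bv; apply: bounded_measurable_integrable => //.
exact: bounded_measurableM.
Qed.

Lemma coord_sq_ge0 (v : T -> 'I_m -> R) i j : 0 <= \int[mu]_x (v x j ^+ 2 * f i x).
Proof.
apply: Rintegral_ge0 => x _; have [_ f0 _] := df i.
by rewrite mulr_ge0// sqr_ge0.
Qed.

Lemma sqnorm_ge0 v : 0 <= sqnorm v.
Proof. by apply: sumr_ge0 => i _; apply: sumr_ge0 => j _; exact: coord_sq_ge0. Qed.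

Lemma sqnorm_ge v i j : \int[mu]_x (v x j ^+ 2 * f i x) <= sqnorm v.
Proof.
rewrite /sqnorm (bigD1 i)//= (bigD1 j)//= -addrA lerDl addr_ge0//.
  by apply: sumr_ge0 => *; exact: coord_sq_ge0.
by apply: sumr_ge0 => *; apply: sumr_ge0 => *; exact: coord_sq_ge0.
Qed.

Lemma sqnorm_le v : V v -> sqnorm v <= \sum_(i < N.+1) \sum_(j < m) M ^+ 2.
Proof.
move=> Vv; apply: ler_sum => i _; apply: ler_sum => j _.
rewrite [leRHS](_ : _ = \int[mu]_x (M ^+ 2 * f i x)); last first.
  by rewrite RintegralZl ?Rintegral_density ?mulr1//; exact: is_density_integrable.
apply: le_Rintegral => //.
- exact/integrable_sq/coord.
- exact/integrableZl_EFin/is_density_integrable.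
move=> x _; have [_ f0 _] := df i; apply: ler_wpM2r => //.
rewrite -real_normK ?num_real// lerXn2r ?nnegrE//; last exact: Vbnd.
exact: le_trans (normr_ge0 _) (Vbnd Vv x j).
Qed.

Lemma sqnorm_parallelogram v v' : V v -> V v' ->
  sqnorm (fun x j => v' x j - v x j) = 2 * sqnorm v + 2 * sqnorm v' -
    4 * sqnorm (fun x j => (1 - 2^-1) * v x j + 2^-1 * v' x j).
Proof.
move=> Vv Vv'; rewrite /sqnorm !mulr_sumr -big_split -sumrB /=.
apply: eq_bigr => i _; rewrite !mulr_sumr -big_split -sumrB /=.
apply: eq_bigr => j _.
have ih : 0 <= (2^-1 : R) <= 1 by lra.
have i1 := integrable_sq i (coord j Vv).
have i2 := integrable_sq i (coord j Vv').
have i3 := integrable_sq i (coord j (Vconv Vv Vv' ih)).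
rewrite -!RintegralZl// -RintegralD//; try exact: integrableZl_EFin.
rewrite -RintegralB//; last 2 first.
- by apply: integrableD_EFin; exact: integrableZl_EFin.
- exact: integrableZl_EFin.
by apply: eq_Rintegral => x _; field.
Qed.

Let feasible e v := V v /\ forall i, w i - e <= payoff v i.
Let infn e := inf [set sqnorm v | v in feasible e].
Let supn := sup [set infn e | e in [set e | 0 < e]].

(* [supn] is the limit of the least norms of nearly feasible points as the
   tolerance shrinks; two near-minimizers have a nearly feasible midpoint, so
   the parallelogram identity makes them close to each other. *)
Lemma near_minimizer eta : 0 < eta -> exists p : R * (T -> 'I_m -> R),
  [/\ 0 < p.1 <= eta, feasible p.1 p.2, sqnorm p.2 <= supn + eta &
      forall v, feasible p.1 v -> supn - eta <= sqnorm v].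
Proof.
move=> eta0.
have hlb e : has_lbound [set sqnorm v | v in feasible e].
  by exists 0 => _ [v _ <-]; exact: sqnorm_ge0.
have hinf e : 0 < e -> has_inf [set sqnorm v | v in feasible e].
  move=> e0; split=> //; have [v Vv hv] := Vapprox e0.
  by exists (sqnorm v), v.
have hsup : has_sup [set infn e | e in [set e | 0 < e]].
  split; first by exists (infn 1), 1 => //=; exact: ltr01.
  exists (\sum_(i < N.+1) \sum_(j < m) M ^+ 2) => _ [e /= e0 <-].
  have [v Vv hv] := Vapprox e0.
  apply: le_trans (sqnorm_le Vv).
  by apply: ge_inf => //; exists v.
have [_ [e0 /= e00 <-] he0] := sup_adherent eta0 hsup.
(* A smaller tolerance shrinks the feasible set, so the lower bound obtained at [e0] persists at
   [e]. *)
pose e := Num.min e0 eta.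
have e_gt0 : 0 < e by rewrite lt_min e00.
have [_ [v Fv <-] hv] := inf_adherent eta0 (hinf _ e_gt0).
exists (e, v); split=> //=.
- by rewrite e_gt0 ge_min lexx orbT.
- apply: (le_trans (ltW hv)); rewrite lerD2r.
  by apply: ub_le_sup; [case: hsup|exists e].
- move=> v' [Vv' hv']; apply: (le_trans (ltW he0)).
  apply: ge_inf => //; exists v' => //; split=> // i.
  apply: le_trans (hv' i); rewrite lerD2l lerN2.
  by rewrite ge_min lexx.
Qed.

(** The midpoint of two consecutive near-minimizers is feasible at the larger of their tolerances,
    so its squared norm is at least [supn - (4 ^+ k)^-1]. The parallelogram identity then bounds
    their squared distance by a geometric term. *)
Lemma min_norm_sequence : exists v_ : nat -> T -> 'I_m -> R,
  [/\ forall k, V (v_ k), forall k i, w i - (4 ^+ k)^-1 <= payoff (v_ k) i &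
      forall k, sqnorm (fun x j => v_ k.+1 x j - v_ k x j) <= 8 / 4 ^+ k].
Proof.
have pow4 k : 0 < (4 ^+ k)^-1 :> R by rewrite invr_gt0 exprn_gt0.
have [p pP] := choice (fun k => near_minimizer (pow4 k)).
exists (fun k => (p k).2); split.
- by move=> k; case: (pP k) => _ [].
- move=> k i; have [/andP[_ pe] [_ h] _ _] := pP k.
  by apply: le_trans (h i); rewrite lerD2l lerN2.
move=> k; have [] := pP k; have [] := pP k.+1.
move: (p k) (p k.+1) => [e v] [e' v'] /=.
move=> /andP[e'0 _] [Vv' Fv'] le' ge' /andP[e0 _] [Vv Fv] le ge.
have ih : 0 <= (2^-1 : R) <= 1 by lra.
rewrite sqnorm_parallelogram//.
have k0 := pow4 k.
have kE : (4 ^+ k.+1)^-1 = 4^-1 * (4 ^+ k)^-1 :> R by rewrite exprS invfM.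
move: le' ge'; rewrite kE => le' ge'.
have mid E : e <= E -> e' <= E -> feasible E
    (fun x j => (1 - 2^-1) * v x j + 2^-1 * v' x j).
  move=> eE e'E; split=> [|i]; first exact: Vconv.
  rewrite (payoff_conv c df Vmeas Vbnd)//.
  by have := Fv i; have := Fv' i; lra.
set Q := sqnorm (fun x j => _ * _ + _).
have : supn - (4 ^+ k)^-1 <= Q.
  have [ee|/ltW ee] := leP e e'; last exact/ge/mid.
  by have := ge' _ (mid _ ee (lexx _)); rewrite -/Q; lra.
lra.
Qed.

(** Passage from [L^2] to [L^1]. The free weight [s] will be [2 ^+ k], which turns squared norms of
    order [(4 ^+ k)^-1] into [L^1] norms of order [(2 ^+ k)^-1]. *)
Lemma coord_L1_le (v : T -> 'I_m -> R) i j (s : R) : bounded_measurable (v^~ j) -> 0 < s ->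
  \int[mu]_x (`|v x j| * f i x) <= s / 2 * sqnorm v + (2 * s)^-1.
Proof.
move=> bv s0.
have I1 : integrable (fun x => s / 2 * (v x j ^+ 2 * f i x)).
  exact/integrableZl_EFin/integrable_sq.
have I2 : integrable (fun x => (2 * s)^-1 * f i x).
  exact/integrableZl_EFin/is_density_integrable.
apply: (@le_trans _ _ (\int[mu]_x (s / 2 * (v x j ^+ 2 * f i x) +
    (2 * s)^-1 * f i x))).
  apply: le_Rintegral => //.
  - apply: bounded_measurable_integrable => //.
    have [mv [K hK]] := bv; split; first exact: measurableT_comp.
    by exists K => x; rewrite normr_id.
  - exact: integrableD_EFin.
  (* AM-GM: [|v| <= s / 2 * v ^ 2 + 1 / (2 * s)] *)
  move=> x _; have [_ f0 _] := df i; rewrite mulrA -mulrDl ler_wpM2r//.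
  rewrite -[v x j ^+ 2]real_normK ?num_real//.
  move: `|v x j| => a; rewrite -subr_ge0.
  have -> : s / 2 * a ^+ 2 + (2 * s)^-1 - a = (s * a - 1) ^+ 2 / (2 * s).
    by field; rewrite gt_eqF.
  by rewrite divr_ge0 ?sqr_ge0// mulr_ge0// ltW.
rewrite RintegralD// [X in X + _]RintegralZl//; last exact: integrable_sq.
rewrite [X in _ + X]RintegralZl//; last exact: is_density_integrable.
rewrite (Rintegral_density (df i)) mulr1 lerD2r ler_wpM2l//; last exact: sqnorm_ge.
by rewrite divr_ge0// ltW.
Qed.
End min_norm.

(** * Almost everywhere convergence and attainment of the payoff vector *)

Lemma cvg_sumR {R : realType} I (s : seq I) (a : I -> nat -> R) (l : I -> R) :
  (forall i, a i @ \oo --> l i) ->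
  (fun k => \sum_(i <- s) a i k) @ \oo --> \sum_(i <- s) l i.
Proof.
move=> al; elim: s => [|i s ih].
  by rewrite big_nil; under eq_fun do rewrite big_nil; exact: cvg_cst.
rewrite big_cons; under eq_fun do rewrite big_cons.
by apply: cvgD.
Qed.

Lemma cvg_summable_increments {R : realType} (a h : nat -> R) :
  (forall k, `|a k.+1 - a k| <= h k) ->
  (\sum_(k <oo) (h k)%:E < +oo)%E -> cvgn a.
Proof.
move=> ah hoo.
have h0 k : (0 <= (h k)%:E)%E by rewrite lee_fin (le_trans _ (ah k)).
set S := (\sum_(k <oo) (h k)%:E)%E in hoo.
have S0 : (0 <= S)%E by apply: nneseries_ge0.
have Sfin : S \is a fin_num by rewrite ge0_fin_numE.
have cs : cvgn (series (telescope a)).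
  apply: normed_cvg; rewrite /normed_series_of; apply: nondecreasing_is_cvgn.
    apply/nondecreasing_seqP => n.
    by rewrite /series/= big_nat_recr//= lerDl.
  exists (fine S) => _ [n _ <-].
  rewrite /series/= -lee_fin fineK// -sumEFin.
  apply: le_trans (nneseries_lim_ge n _) => //.
  by apply: lee_sum => k _; rewrite lee_fin; exact: ah.
rewrite (_ : a = (fun n => a 0%N + series (telescope a) n)).
  by apply: is_cvgD => //; exact: is_cvg_cst.
by apply/funext => n; exact: eq_sum_telescope.
Qed.

Section limits.
Context d (T : measurableType d) (R : realType) (mu : {measure set T -> \bar R}).
Local Notation integrable h := (mu.-integrable setT (EFin \o h)).

Lemma cvg_dominated_Rintegral (h_ : nat -> T -> R) (h g : T -> R) :
  (forall k, measurable_fun setT (h_ k)) -> (forall k x, `|h_ k x| <= g x) ->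
  integrable g -> (forall x, h_ ^~ x @ \oo --> h x) ->
  (fun k => \int[mu]_x h_ k x) @ \oo --> \int[mu]_x h x.
Proof.
move=> mh hg ig hh.
have mhl : measurable_fun setT h by apply: (measurable_fun_cvg mh) => x _; exact: hh.
have [||||ih _] := @dominated_convergence _ _ _ mu setT measurableT
  (fun k x => (h_ k x)%:E) (EFin \o h) (EFin \o g) _ _ _ ig.
- by move=> k; exact/measurable_EFinP.
- exact/measurable_EFinP.
- by apply: aeW => x _; apply/fine_cvgP; split; [exact: nearW|exact: hh].
- by apply: aeW => x k _; rewrite lee_fin.
by rewrite (integral_Rintegral ih) => /fine_cvg.
Qed.

(** The series weighted by [f] has integral at most a geometric sum, hence is finite almost
    everywhere; [f x] can be divided out wherever it is nonzero. *)
Lemma ae_summable (f : T -> R) (h : nat -> T -> R) (K : R) : is_density mu f ->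
  (forall k, measurable_fun setT (h k)) -> (forall k x, 0 <= h k x) ->
  (forall k, integrable (fun x => h k x * f x)) ->
  (forall k, \int[mu]_x (h k x * f x) <= K / 2 ^+ k) ->
  {ae mu, forall x, (\sum_(k <oo) (h k x)%:E < +oo)%E \/ f x = 0}.
Proof.
move=> df mh h0 ih hK; have [mf f0 _] := df.
have K0 : 0 <= K.
  have := hK 0%N; rewrite expr0 divr1; apply: le_trans.
  by apply: Rintegral_ge0 => x _; rewrite mulr_ge0.
pose S x := (\sum_(k <oo) (h k x * f x)%:E)%E.
have mS : measurable_fun setT S.
  apply: ge0_emeasurable_sum => [k x _ _|k _]; first by rewrite lee_fin mulr_ge0.
  by apply/measurable_EFinP/measurable_funM.
have S0 x : (0 <= S x)%E by apply: nneseries_ge0 => k _ _; rewrite lee_fin mulr_ge0.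
have iS : mu.-integrable setT S.
  apply/integrableP; split=> //.
  under eq_integral do rewrite gee0_abs//.
  rewrite /S integral_nneseries//; last 2 first.
  - by move=> k; apply/measurable_EFinP/measurable_funM.
  - by move=> k x _; rewrite lee_fin mulr_ge0.
  (* [K / 2 ^+ k] is rewritten as [(K *+ 2) / 2 ^ (k + 1)] to match the summation formula for the
     geometric series of ratio one half. *)
  apply: (@le_lt_trans _ _ (\sum_(k <oo) ((K *+ 2) / (2 ^ (k + 1))%:R)%:E)%E).
    apply: lee_nneseries => [k _ _|k _].
      by apply: integral_ge0 => x _; rewrite lee_fin mulr_ge0.
    rewrite integral_Rintegral// lee_fin; apply: (le_trans (hK k)).
    have k0 : 2 ^+ k != 0 :> R by rewrite expf_neq0.
    rewrite natrX addn1 exprS le_eqVlt; apply/orP; left; apply/eqP.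
    by field.
  have := @cvg_geometric_eseries_half R (K *+ 2) 0.
  by move=> /cvg_lim; rewrite /eseries => -> //; rewrite ltry.
have := integrable_ae measurableT iS.
apply: filterS => x /(_ I) Sx.
have [->|fx] := eqVneq (f x) 0; [by right|left].
have -> : (\sum_(k <oo) (h k x)%:E = (f x)^-1%:E * S x)%E.
  rewrite /S -nneseriesZl//; last by move=> k _; rewrite lee_fin mulr_ge0.
  by apply: eq_eseriesr => k _; rewrite -EFinM mulrCA mulVf// mulr1.
by rewrite -(fineK Sx) -EFinM ltry.
Qed.

Variables (N m : nat) (f : 'I_N.+1 -> T -> R) (c : 'I_N.+1 -> 'I_m -> R).
Variables (V : (T -> 'I_m -> R) -> Prop) (M : R) (w : 'I_N.+1 -> R).
Hypothesis df : forall i, is_density mu (f i).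
Hypothesis Vmeas : forall v, V v -> forall j, measurable_fun setT (v^~ j).
Hypothesis Vbnd : forall v, V v -> forall x j, `|v x j| <= M.
Hypothesis Vconv : forall v v' (t : R), V v -> V v' -> 0 <= t <= 1 ->
  V (fun x j => (1 - t) * v x j + t * v' x j).
Hypothesis Vpaste : forall v v' (G : set T), V v -> V v' -> measurable G ->
  V (fun x => if x \in G then v x else v' x).
Hypothesis Vopt : forall l, simplex l -> forall e : R, 0 < e ->
  exists2 v, V v & \sum_i l i * w i - e <= \sum_i l i * payoff mu f c v i.

(** The increments of the minimal-norm sequence are summable almost everywhere for each law [f i],
    and dominated convergence carries the payoffs to the limit. The sequence is part of the
    conclusion because [V] is not assumed closed: each application studies its own limit. *)
Theorem payoff_attained : exists v_ v,
  [/\ forall k, V (v_ k), forall x j, v_ ^~ x ^~ j @ \oo --> v x j &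
      forall i, w i <= payoff mu f c v i].
Proof.
have [v_ [Vv v_w v_sq]] :=
  min_norm_sequence df Vmeas Vbnd Vconv (payoff_approx df Vmeas Vbnd Vconv Vopt).
have bv k j : bounded_measurable (v_ k ^~ j).
  exact (bounded_measurable_coord Vmeas Vbnd j (Vv k)).
have bd k j : bounded_measurable (fun x => v_ k.+1 x j - v_ k x j).
  have := bounded_measurableD (bv k.+1 j)
    (bounded_measurableM (bounded_measurable_cst _ (-1)) (bv k j)).
  by under eq_fun do rewrite mulN1r.
pose h k x := \sum_j `|v_ k.+1 x j - v_ k x j|.
have bh k : bounded_measurable (h k).
  apply: bounded_measurable_sum => j; have [md [K hK]] := bd k j.
  by split; [exact: measurableT_comp|exists K => x; rewrite normr_id].
have mh k : measurable_fun setT (h k) by case: (bh k).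
have h0 k x : 0 <= h k x by exact: sumr_ge0.
pose G := [set x | (\sum_(k <oo) (h k x)%:E < +oo)%E].
have mG : measurable G.
  rewrite -[G]setTI; apply: measurable_lte => //.
  apply: ge0_emeasurable_sum => [k x _ _|k _]; first by rewrite lee_fin.
  exact/measurable_EFinP.
have aeG i : {ae mu, forall x, G x \/ f i x = 0}.
  (* With weight [2 ^+ k], each of the [m] coordinates contributes at most [4 / 2 ^+ k] plus half of
     [(2 ^+ k)^-1], hence less than [5 / 2 ^+ k]. *)
  apply: (@ae_summable _ h (m%:R * 5)) => // k.
    exact: bounded_measurable_integrable.
  under eq_Rintegral do rewrite /h mulr_suml.
  rewrite Rintegral_sum; last first.
    move=> j; apply: bounded_measurable_integrable => //.
    have [md [K hK]] := bd k j.
    by split; [exact: measurableT_comp|exists K => x; rewrite normr_id].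
  rewrite -mulrA mulr_natl -[X in _ *+ X]card_ord -sumr_const.
  apply: ler_sum => j _.
  have k0 : 0 < 2 ^+ k :> R by rewrite exprn_gt0.
  have := coord_L1_le (v := fun x j => v_ k.+1 x j - v_ k x j) df i (bd k j) k0.
  move/le_trans; apply.
  have : 2 ^+ k / 2 * sqnorm mu f (fun x j => v_ k.+1 x j - v_ k x j) <=
         2 ^+ k / 2 * (8 / 4 ^+ k) by rewrite ler_wpM2l// divr_ge0// ltW.
  have -> : 4 ^+ k = 2 ^+ k * 2 ^+ k :> R by rewrite -exprMn; congr (_ ^+ _); ring.
  have -> : 2 ^+ k / 2 * (8 / (2 ^+ k * 2 ^+ k)) = 4 / 2 ^+ k :> R.
    by field; rewrite gt_eqF.
  rewrite invfM; have : 0 < (2 ^+ k)^-1 :> R by rewrite invr_gt0.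
  move: (2 ^+ k)^-1 => z; lra.
(* Freezing the sequence outside [G] makes it converge at every point. Payoffs are unchanged, since
   almost everywhere outside [G] the densities vanish. *)
pose v' k x := if x \in G then v_ k x else v_ 0%N x.
have Vv' k : V (v' k) by exact: Vpaste.
have cv x j : cvgn (v' ^~ x ^~ j).
  rewrite /v'; have [|_] := boolP (x \in G); last exact: is_cvg_cst.
  rewrite inE => Gx; apply: (@cvg_summable_increments _ _ (h ^~ x)) => // k.
  by rewrite /h (bigD1 j)//= lerDl sumr_ge0.
exists v', (fun x j => limn (v' ^~ x ^~ j)); split=> // i.
have pE k : payoff mu f c (v' k) i = payoff mu f c (v_ k) i.
  rewrite /payoff /Rintegral; congr fine; apply: ae_eq_integral => //.
  - exact/measurable_EFinP/integrable_measurable/(integrable_payoff c df Vmeas Vbnd).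
  - exact/measurable_EFinP/integrable_measurable/(integrable_payoff c df Vmeas Vbnd).
  apply: filterS (aeG i) => x xP _; congr EFin.
  case: xP => [Gx|->]; last by rewrite !mulr0.
  by rewrite /v' mem_set.
have pcv : (fun k => payoff mu f c (v' k) i) @ \oo -->
    payoff mu f c (fun x j => limn (v' ^~ x ^~ j)) i.
  apply: (@cvg_dominated_Rintegral _ _ (fun x => \sum_j `|c i j| * M * f i x)).
  - by move=> k; exact/integrable_measurable/(integrable_payoff c df Vmeas Vbnd).
  - move=> k x; have [_ f0 _] := df i.
    rewrite normrM (ger0_norm (f0 x)) -mulr_suml ler_wpM2r//.
    apply: le_trans (ler_norm_sum _ _ _) _; apply: ler_sum => j _.
    by rewrite normrM ler_wpM2l// Vbnd.
  - apply: integrable_sum_EFin => j; apply: integrableZl_EFin.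
    exact: is_density_integrable.
  move=> x; apply: cvgMr_tmp.
  by apply: cvg_sumR => j; apply: cvgMl_tmp; exact: cv.
have e0 : (fun k => w i - (4 ^+ k)^-1) @ \oo --> w i - 0.
  apply: cvgB; first exact: cvg_cst.
  have := @cvg_geometric R 1 4^-1; rewrite ger0_norm ?invr_ge0// => /(_ _)/=.
  rewrite /geometric/=; under eq_fun do rewrite mul1r exprVn.
  by apply; lra.
rewrite subr0 in e0.
apply: (ler_cvg_to e0 pcv).
by apply: nearW => k; rewrite pE.
Qed.
End limits.

(** * Finite approximations of decision problems *)

Section nets.
Context {R : realType}.

Lemma finite_net_segment m (al ar : R) (F : 'I_m -> R -> R) : al <= ar ->
  (forall i a, al <= a <= ar -> {for a, continuous (F i)}) ->
  forall e, 0 < e -> exists a s, [/\ path <=%R a s,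
    forall b, b \in a :: s -> al <= b <= ar &
    forall a', al <= a' <= ar ->
      exists2 b, b \in a :: s & forall i, `|F i a' - F i b| <= e].
Proof.
move=> alr Fc e e0.
(* The interior is taken because continuity is known only at points of the segment, so the set
   itself may fail to be open. *)
pose U (a : R) := [set a' | forall i, `|F i a' - F i a| < e]°.
have Uin a : al <= a <= ar -> U a a.
  move=> aI; rewrite /U /interior /=.
  apply: (@filter_forall R 'I_m (fun i y => `|F i y - F i a| < e) (nbhs a)) => i.
  have /cvgrPdist_lt/(_ _ e0) := Fc i a aI.
  by apply: filterS => y; rewrite distrC.
have := @segment_compact R al ar; rewrite compact_cover.
move=> /(_ R `[al, ar]%classic U) [||D DI Dcov].
- by move=> a _; exact: open_interior.
- by move=> a /= aI; exists a => //; apply: Uin; move: aI; rewrite in_itv.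
have : sorted <=%R (sort <=%R (enum_fset D)) by exact/sort_sorted/le_total.
have memD b : b \in sort <=%R (enum_fset D) = (b \in D).
  by rewrite mem_sort.
move: memD; case: (sort _ _) => [|a s] memD.
  have [|b /=] := Dcov al; first by rewrite /= in_itv /= lexx alr.
  by rewrite -memD.
move=> /= pas; exists a, s; split=> //.
  by move=> b; rewrite memD => /DI/set_mem; rewrite /= in_itv.
move=> a' a'I; have [|b /= bD bU] := Dcov a'; first by rewrite /= in_itv.
exists b => [|i]; first by rewrite memD.
by apply/ltW; exact: (interior_subset bU).
Qed.

Context {n : nat}.
Implicit Types (A : set R) (u : R -> 'I_n.+1 -> R).

Lemma derivable_continuous1 (F : R -> R) (a : R) :
  derivable F a 1 -> {for a, continuous F}.
Proof. by move=> /derivable1_diffP/differentiable_continuous. Qed.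

(** Treats both kinds of problem alike: a finite action set is its own net, and an interval has one
    by compactness and continuity of the finitely many utilities. *)
Lemma decision_problem_net A u : decision_problem A u ->
  forall e, 0 < e -> exists a s, [/\ path <=%R a s, [set` a :: s] `<=` A &
    forall a', A a' -> exists2 b, b \in a :: s & forall i, `|u a' i - u b i| <= e].
Proof.
move=> [[/finite_seqP[t At] [a0 Aa0]]|[al [ar [alr -> du]]]] e e0.
  have : sorted <=%R (sort <=%R t) by exact/sort_sorted/le_total.
  have memt b : b \in sort <=%R t = (b \in t) by rewrite mem_sort.
  move: memt; case: (sort _ _) => [|a s] memt /= pas.
    by move: Aa0; rewrite At /= -memt.
  exists a, s; split=> //; first by move=> b /=; rewrite memt At.
  move=> b; rewrite At /= -memt => bs; exists b => // i.
  by rewrite subrr normr0 ltW.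
have [|a [s [pas asI H]]] :=
    @finite_net_segment _ al ar (fun i a => u a i) alr _ e e0.
  by move=> i a aI; apply/derivable_continuous1/du; rewrite /= in_itv.
by exists a, s; split.
Qed.

Lemma decision_problem_neq0 A u : decision_problem A u -> A !=set0.
Proof.
move=> /decision_problem_net/(_ _ ltr01)[a [s [_ sA _]]].
by exists a; apply: sA; rewrite /= in_cons eqxx.
Qed.

Lemma decision_problem_bounded A u : decision_problem A u ->
  exists M, forall a i, A a -> `|u a i| <= M.
Proof.
move=> /decision_problem_net/(_ _ ltr01)[a [s [_ _ H]]].
exists (\sum_(b <- a :: s) \sum_i `|u b i| + 1) => b i /H[c cs /(_ i) bc].
apply: (@le_trans _ _ (`|u c i| + `|u b i - u c i|)).
  by rewrite -{1}(subrKC (u c i) (u b i)) ler_normD.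
rewrite lerD// (big_rem c cs)/= (bigD1 i)//= -addrA lerDl addr_ge0//.
  by apply: sumr_ge0.
by apply: sumr_ge0 => d _; apply: sumr_ge0.
Qed.

Lemma finite_set_measurable A : finite_set A -> measurable A.
Proof.
move=> /finite_set_countable; apply: countable_measurable => t.
exact: measurable_set1.
Qed.

Lemma decision_problem_measurable A u : decision_problem A u -> measurable A.
Proof.
case=> [[fA _]|[al [ar [_ -> _]]]]; last exact: measurable_itv.
exact: finite_set_measurable.
Qed.

Lemma decision_problem_measurable_fun A u i : decision_problem A u ->
  measurable_fun A (u ^~ i).
Proof.
case=> [[fA _]|[al [ar [_ -> du]]]].
  move=> mA Y _; apply: finite_set_measurable => //.
  by apply: sub_finite_set fA => x [].
apply: subspace_continuous_measurable_fun; first exact: measurable_itv.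
apply: continuous_in_subspaceT => a /set_mem aI.
exact/derivable_continuous1/du.
Qed.

Lemma QCC_subset A B u : B `<=` A -> QCC A u -> QCC B u.
Proof.
move=> BA qA p hp a b c Ba Bb Bc; apply: qA => //; exact: BA.
Qed.

Lemma Vval_net A u (e : R) a s (p : 'I_n -> R) :
  (exists M, forall a i, A a -> `|u a i| <= M) ->
  [set` a :: s] `<=` A ->
  (forall a', A a' -> exists2 b, b \in a :: s & forall i, `|u a' i - u b i| <= e) ->
  in_hsimplex p ->
  maxs (ubel u ^~ p) a s <= Vval A u p <= maxs (ubel u ^~ p) a s + e.
Proof.
move=> [M uM] sA H /fullb_simplex[p0 p1].
have Aa : A a by apply: sA; rewrite /= in_cons eqxx.
apply/andP; split.
  have [b bs ->] := maxs_mem (ubel u ^~ p) a s.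
  apply: ub_le_sup; last by exists b => //; exact: sA.
  exists M => _ [c Ac <-]; rewrite -[M]mul1r -p1 mulr_suml.
  apply: ler_sum => i _; rewrite ler_wpM2l//.
  exact: le_trans (ler_norm _) (uM _ _ Ac).
apply: ge_sup; first by exists (ubel u a p), a.
move=> _ [c /H[b bs cb] <-].
apply: (@le_trans _ _ (ubel u b p + e)); last first.
  by rewrite lerD2r; exact: (@maxs_ge _ (ubel u ^~ p)).
rewrite /ubel -[X in _ + X]mul1r -p1 mulr_suml -big_split /=.
apply: ler_sum => i _; rewrite -mulrDr ler_wpM2l// -lerBlDl.
exact: le_trans (ler_norm _) (cb i).
Qed.
End nets.

(** * Comparison of expected values in the zonoid order *)

Lemma maxs_scale {R : realType} (phi : R -> R) (k : R) a s : 0 <= k ->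
  maxs (fun b => k * phi b) a s = k * maxs phi a s.
Proof. by move=> k0; elim: s a => [|b s ih] a //=; rewrite ih maxr_pMr. Qed.

Section value_comparison.
Context {R : realType} {n : nat}.
Local Notation mu := (@lebesgue_measure R).
Implicit Types (f g : 'I_n.+1 -> R -> R) (q : 'I_n -> R) (h : ('I_n -> R) -> R).
Local Notation integrable h := (mu.-integrable setT (EFin \o h)).

(** Uniform approximation from below by values of finite QCC problems. Value functions and convex
    functions of [b . p] both have this property, so one comparison serves for both. *)
Definition qc_approximable h := forall e, 0 < e ->
  exists a s (u : R -> 'I_n.+1 -> R), [/\ path <=%R a s, QCC [set` a :: s] u &
    forall p, in_hsimplex p ->
      maxs (ubel u ^~ p) a s <= h p <= maxs (ubel u ^~ p) a s + e].

Let pointwise_bound f q h u a s e : in_hsimplex q ->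
  (forall i x, 0 <= f i x) ->
  (forall p, in_hsimplex p ->
      maxs (ubel u ^~ p) a s <= h p <= maxs (ubel u ^~ p) a s + e) ->
  forall x, maxs (score u (fun i => fullb q i * f i x)) a s <=
    mixdens f q x * h (posterior f q x) <=
    maxs (score u (fun i => fullb q i * f i x)) a s + mixdens f q x * e.
Proof.
move=> hq f0 H x; have f0x i := f0 i x.
have -> : maxs (score u (fun i => fullb q i * f i x)) a s =
    mixdens f q x * maxs (ubel u ^~ (posterior f q x)) a s.
  rewrite -maxs_scale ?mixdens_ge0//; congr maxs; apply/funext => b.
  by rewrite mixdens_ubel.
have [m0|m0] := eqVneq (mixdens f q x) 0; first by rewrite m0 !mul0r addr0 lexx.
have /andP[H1 H2] := H _ (posterior_hsimplex hq f0x m0).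
by rewrite -mulrDr !ler_wpM2l// mixdens_ge0.
Qed.

Let integrable_mixdens f q : (forall i, is_density mu (f i)) ->
  integrable (mixdens f q).
Proof.
move=> df; apply: integrable_sum_EFin => i; apply: integrableZl_EFin.
exact: is_density_integrable.
Qed.

Let Rintegral_mixdens f q : in_hsimplex q -> (forall i, is_density mu (f i)) ->
  \int[mu]_x mixdens f q x = 1.
Proof.
move=> /fullb_simplex[_ q1] df; rewrite Rintegral_sum; last first.
  by move=> i; apply/integrableZl_EFin/is_density_integrable.
rewrite -[RHS]q1; apply: eq_bigr => i _.
rewrite RintegralZl ?Rintegral_density ?mulr1//.
exact: is_density_integrable.
Qed.

(** The integrand is a pointwise limit of maxima of scores, hence measurable; the approximation with
    error 1 dominates it by an integrable function. *)
Lemma integrable_posterior f q h : in_hsimplex q ->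
  (forall i, is_density mu (f i)) -> qc_approximable h ->
  integrable (fun x => mixdens f q x * h (posterior f q x)).
Proof.
move=> hq df happ.
have f0 i x : 0 <= f i x by case: (df i).
have m0 x : 0 <= mixdens f q x by apply: mixdens_ge0.
have /choice[b bP] : forall k, exists b : (R * seq R) * (R -> 'I_n.+1 -> R),
    forall x, maxs (score b.2 (fun i => fullb q i * f i x)) b.1.1 b.1.2 <=
    mixdens f q x * h (posterior f q x) <=
    maxs (score b.2 (fun i => fullb q i * f i x)) b.1.1 b.1.2 +
    mixdens f q x * k.+1%:R^-1.
  move=> k.
  have k0 : 0 < k.+1%:R^-1 :> R by rewrite invr_gt0.
  have [a [s [u [_ _ H]]]] := happ _ k0.
  by exists ((a, s), u); exact: pointwise_bound.
have mH : measurable_fun setT (fun x => mixdens f q x * h (posterior f q x)).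
  pose S k x := maxs (score (b k).2 (fun i => fullb q i * f i x)) (b k).1.1 (b k).1.2.
  apply: (@measurable_fun_cvg _ _ _ _ S) => [k|x _].
    by apply: (@integrable_measurable _ _ _ mu); exact: integrable_maxs.
  have h0 : (fun k => mixdens f q x * k.+1%:R^-1) @ \oo --> mixdens f q x * 0.
    by apply: cvgMl_tmp; exact: cvg_harmonic.
  rewrite mulr0 in h0.
  have h1 : (fun k => mixdens f q x * h (posterior f q x) -
      mixdens f q x * k.+1%:R^-1) @ \oo --> mixdens f q x * h (posterior f q x).
    by rewrite -[X in _ --> X]subr0; apply: cvgB => //; exact: cvg_cst.
  have Sh : \forall k \near \oo,
      mixdens f q x * h (posterior f q x) - mixdens f q x * k.+1%:R^-1 <=
      S k x <= mixdens f q x * h (posterior f q x).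
    apply: nearW => k; have /andP[] := bP k x; rewrite -/(S k x) => -> ?.
    by rewrite andbT lerBlDr.
  by apply: (squeeze_cvgr Sh h1); exact: cvg_cst.
pose S x := maxs (score (b 0%N).2 (fun i => fullb q i * f i x)) (b 0%N).1.1 (b 0%N).1.2.
have iS : integrable S by exact: integrable_maxs.
apply: (@le_integrable_EFin _ _ _ mu (fun x => mixdens f q x * h (posterior f q x))
  (fun x => `|S x| + mixdens f q x)) => //.
  move=> x; have := bP 0%N x; rewrite invr1 mulr1 -/(S x).
  move: (m0 x) => m1; move: (mixdens f q x * h _) => z /andP[zS Sz].
  have := ler_norm (S x); have := ler_norm (- S x); rewrite normrN ler_norml.
  by move=> ? ?; apply/andP; split; lra.
apply: integrableD_EFin; last exact: integrable_mixdens.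
exact: integrable_norm.
Qed.

(** Finite problems below [h] are compared by [zonoid_le_maxs]. Only the upper bound under [g] costs
    [e], because the mixture density integrates to one. *)
Lemma zonoid_le_posterior f g q h : in_hsimplex q ->
  (forall i, is_density mu (f i)) -> (forall i, is_density mu (g i)) ->
  zonoid_le mu g f -> qc_approximable h ->
  \int[mu]_x (mixdens g q x * h (posterior g q x)) <=
  \int[mu]_x (mixdens f q x * h (posterior f q x)).
Proof.
move=> hq df dg gf happ; apply/ler_addgt0Pr => e e0.
have [a [s [u [pas qc H]]]] := happ _ e0.
have f0 i x : 0 <= f i x by case: (df i).
have g0 i x : 0 <= g i x by case: (dg i).
have q0 : forall i, 0 <= fullb q i by case: (fullb_simplex hq).
apply: (@le_trans _ _ (\int[mu]_x (maxs (score u (fun i => fullb q i * g i x)) a s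
    + e * mixdens g q x))).
  apply: le_Rintegral => //.
  - exact: integrable_posterior.
  - apply: integrableD_EFin; first exact: integrable_maxs.
    exact/integrableZl_EFin/integrable_mixdens.
  move=> x _; rewrite [e * _]mulrC.
  by have /andP[] := pointwise_bound hq g0 H x.
rewrite RintegralD//; last 2 first.
- exact: integrable_maxs.
- exact/integrableZl_EFin/integrable_mixdens.
rewrite [X in _ + X]RintegralZl//; last exact: integrable_mixdens.
rewrite Rintegral_mixdens// mulr1 lerD2r.
apply: le_trans (zonoid_le_maxs df dg gf pas qc q0) _.
apply: le_Rintegral => //.
- exact: integrable_maxs.
- exact: integrable_posterior.
by move=> x _; have /andP[] := pointwise_bound hq f0 H x.
Qed.

Lemma qc_approximable_Vval A (u : R -> 'I_n.+1 -> R) :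
  decision_problem A u -> QCC A u -> qc_approximable (Vval A u).
Proof.
move=> dA qA e e0.
have [a [s [pas sA H]]] := decision_problem_net dA e0.
exists a, s, u; split=> //; first exact: QCC_subset qA.
by move=> p hp; apply: Vval_net => //; exact: decision_problem_bounded dA.
Qed.
End value_comparison.

(** * Convex functions as values of tangent-line problems *)

Section tangents.
Context {R : realType} {n : nat}.

Lemma convex_functionP (C : R -> R) : @convex_function R R^o setT C ->
  forall x y t, 0 <= t <= 1 ->
    C (t * x + (1 - t) * y) <= t * C x + (1 - t) * C y.
Proof.
move=> cC x y t t01.
have /andP[t0 t1] := t01.
have := cC (Itv01 t0 t1) x y (mem_set I) (mem_set I).
by rewrite !convRE /=.
Qed.

(** The subgradient at [a] is the supremum of the slopes of chords arriving from the left; by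
    convexity every chord leaving to the right has a slope at least as large. *)
Lemma convex_subgradient (C : R -> R) : @convex_function R R^o setT C ->
  exists s : R -> R, forall a t, C a + s a * (t - a) <= C t.
Proof.
move=> /convex_functionP cC.
pose L a := [set (C a - C x) / (a - x) | x in [set x | x < a]].
have slope a x y : x < a -> a < y -> (C a - C x) / (a - x) <= (C y - C a) / (y - a).
  move=> xa ay.
  have xy : 0 < y - x by lra.
  have := cC x y ((y - a) / (y - x)).
  have -> : 0 <= (y - a) / (y - x) <= 1.
    by rewrite divr_ge0 ?ler_pdivrMr//=; lra.
  move=> /(_ isT).
  have -> : (y - a) / (y - x) * x + (1 - (y - a) / (y - x)) * y = a.
    by field; rewrite gt_eqF.
  have -> : (y - a) / (y - x) * C x + (1 - (y - a) / (y - x)) * C y =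
    ((y - a) * C x + (a - x) * C y) / (y - x) by field; rewrite gt_eqF.
  rewrite ler_pdivlMr// => h.
  by rewrite ler_pdivrMr ?subr_gt0// mulrAC ler_pdivlMr ?subr_gt0//; lra.
have L0 a : L a !=set0.
  by exists ((C a - C (a - 1)) / (a - (a - 1))); exists (a - 1) => //=; lra.
have Lub a y : a < y -> ubound (L a) ((C y - C a) / (y - a)).
  by move=> ay _ [x /= xa <-]; exact: slope.
exists (fun a => sup (L a)) => a t.
have [ta|at_|->] := ltgtP t a; last by rewrite subrr mulr0 addr0.
  have : (C a - C t) / (a - t) <= sup (L a).
    apply: ub_le_sup; last by exists t.
    by exists ((C (a + 1) - C a) / (a + 1 - a)); apply: Lub; lra.
  rewrite ler_pdivrMr ?subr_gt0//; lra.
have : sup (L a) <= (C t - C a) / (t - a) by apply: ge_sup => //; exact: Lub.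
rewrite ler_pdivlMr ?subr_gt0//; lra.
Qed.

(* The decision problem whose action [a] is the tangent line of [C] at [a]. *)
Lemma ubel_affine (C s b : R -> R) (d : 'I_n -> R) a p :
  ubel (fun a i => C a + s a * ((if unlift ord0 i is Some j then d j else 0) - a)) a p
  = C a + s a * (\sum_i d i * p i - a).
Proof.
rewrite /ubel big_ord_recl unlift_none fullb0.
under [X in _ + X]eq_bigr do rewrite liftK fullb_lift.
rewrite [X in _ + X](_ : _ = (\sum_i p i) * (C a - s a * a) +
    s a * \sum_i d i * p i); last first.
  rewrite mulr_suml mulr_sumr -big_split /=; apply: eq_bigr => i _; ring.
ring.
Qed.

(** The tangent at [c] misses [C T] by at most [(s T - s c) * (T - c)]. Since [T = b . p] stays in
    [[-B, B]], a net of tangent points of mesh [e / K] makes this at most [e]. *)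
Lemma qc_approximable_convex (C : R -> R) (b : 'I_n -> R) :
  @convex_function R R^o setT C ->
  qc_approximable (fun p => C (\sum_i b i * p i)).
Proof.
move=> /convex_subgradient[s sP] e e0.
pose B := \sum_i `|b i|.
have B0 : 0 <= B by apply: sumr_ge0.
have smono x y : x < y -> s x <= s y.
  move=> xy; have := sP x y; have := sP y x => h1 h2.
  have : s x * (y - x) <= s y * (y - x) by lra.
  by rewrite ler_pM2r// subr_gt0.
(* [K] bounds the variation of the slope on [[-B, B]]; the added 1 keeps it positive when the slope
   is constant. *)
pose K := s B - s (- B) + 1.
have smono' x y : x <= y -> s x <= s y.
  by rewrite le_eqVlt => /orP[/eqP ->//|/smono].
have sBB : s (- B) <= s B by apply: smono'; lra.
have K0 : 0 < K by rewrite /K; lra.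
have [|||a [t [pat tB H]]] := @finite_net_segment R 1 (- B) B (fun _ => id) _ _ (e / K).
- by lra.
- by move=> _ x _; exact: cvg_id.
- by rewrite divr_gt0.
exists a, t, (fun a i => C a + s a *
  ((if unlift ord0 i is Some j then b j else 0) - a)); split=> //.
  move=> p _ x y z _ _ _ xy yz; rewrite !ubel_affine//.
  (* As [s] is nondecreasing, the value at [T] of the tangent line rises as the point of tangency
     approaches [T] from either side. *)
  set T := \sum_i _; rewrite ge_min.
  have [yT|Ty] := leP y T; apply/orP; [left|right].
    have := sP x y; have : (s y - s x) * (T - y) >= 0.
      by rewrite mulr_ge0 ?subr_ge0 ?smono'.
    lra.
  have := sP z y; have : (s z - s y) * (y - T) >= 0.
    by rewrite mulr_ge0 ?subr_ge0 ?smono' ?(ltW Ty).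
  lra.
move=> p [p0 p1]; set T := \sum_i b i * p i.
have p1' i : p i <= 1.
  by apply: le_trans p1; rewrite (bigD1 i)//= lerDl sumr_ge0.
have TB : - B <= T <= B.
  rewrite -ler_norml; apply: le_trans (ler_norm_sum _ _ _) _.
  by apply: ler_sum => i _; rewrite normrM (ger0_norm (p0 i)) ler_piMr.
apply/andP; split.
  have [c _ ->] := maxs_mem (ubel (fun a i => C a + s a *
     ((if unlift ord0 i is Some j then b j else 0) - a)) ^~ p) a t.
  by rewrite ubel_affine.
have [c ct /(_ ord0)/= cT] := H T TB.
apply: (@le_trans _ _ (C c + s c * (T - c) + e)); last first.
  by rewrite lerD2r -ubel_affine// maxs_ge.
have := sP T c; have : (s T - s c) * (T - c) <= e.
  apply: le_trans (ler_norm _) _; rewrite normrM.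
  apply: (@le_trans _ _ (K * (e / K))).
    apply: ler_pM => //.
    have := tB _ ct => /andP[Bc cB]; have /andP[BT TB'] := TB.
    have := smono' _ _ Bc; have := smono' _ _ cB.
    have := smono' _ _ BT; have := smono' _ _ TB'.
    by rewrite ler_norml /K => *; apply/andP; split; lra.
  by rewrite mulrC divfK// gt_eqF.
lra.
Qed.
End tangents.

(** * Pure dominance and measurable selections *)

Section pure_dominance.
Context {R : realType} {n : nat}.
Variables (al ar : R) (u : R -> 'I_n.+1 -> R).
Hypothesis uc : forall i a, al <= a <= ar -> {for a, continuous (u ^~ i)}.
Hypothesis qc : QCC `[al, ar]%classic u.

(* If [c] were worse than the mixture of [a] and [b] in both states [i] and [j],
   it would be worse than both [a] and [b] at the belief on [{i, j}] at which
   [a] and [b] are equally good, against quasi-concavity. *)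
Let pair_crossing a b c i j t : al <= a -> b <= ar -> a <= c -> c <= b ->
  0 <= t <= 1 -> (1 - t) * u a j + t * u b j <= u a j ->
  u a i < (1 - t) * u a i + t * u b i ->
  u c j < (1 - t) * u a j + t * u b j ->
  (1 - t) * u a i + t * u b i <= u c i.
Proof.
move=> ala bar ac cb /andP[t0 t1] wj wi cj.
have di : 0 < u b i - u a i.
  have : 0 < t * (u b i - u a i) by lra.
  by move=> h; rewrite ltNge; apply: contraTN h => h; rewrite -leNgt mulr_ge0_le0.
have t_gt0 : 0 < t.
  by rewrite lt_neqAle t0 andbT; apply/eqP => t00; move: wi; rewrite -t00; lra.
have dj : 0 <= u a j - u b j.
  have : 0 <= t * (u a j - u b j) by lra.
  by rewrite pmulr_rge0.
(* Unnormalized belief weighting [j] by the gain of [b] over [a] in [i], and [i] by its loss in [j],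
   which equalizes the scores of [a] and [b]. *)
pose nu k := (u b i - u a i) * (k == j)%:R + (u a j - u b j) * (k == i)%:R.
have nuE y : score u nu y = (u b i - u a i) * u y j + (u a j - u b j) * u y i.
  rewrite /score /nu; under eq_bigr do rewrite mulrDl.
  rewrite big_split /= (bigD1 j)//= eqxx [X in _ + X + _]big1 ?addr0; last first.
    by move=> k /negbTE ->; rewrite mulr0 mul0r.
  rewrite (bigD1 i)//= eqxx [X in _ + (_ + X)]big1 ?addr0; last first.
    by move=> k /negbTE ->; rewrite mulr0 mul0r.
  by rewrite !mulr1.
have nu0 k : 0 <= nu k by rewrite addr_ge0// mulr_ge0// ltW.
have inA y : a <= y -> y <= b -> `[al, ar]%classic y.
  by move=> ay yb; rewrite /= in_itv /=; apply/andP; split; lra.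
have := score_qc qc nu0 (inA a _ _) (inA c _ _) (inA b _ _) ac cb.
rewrite !nuE => /(_ (lexx a) (le_trans ac cb) ac cb (le_trans ac cb) (lexx b)).
have -> : (u b i - u a i) * u b j + (u a j - u b j) * u b i =
          (u b i - u a i) * u a j + (u a j - u b j) * u a i by ring.
rewrite minxx leNgt => h; rewrite leNgt; apply: contraNN h => ci.
have : (u b i - u a i) * u c j < (u b i - u a i) * ((1 - t) * u a j + t * u b j).
  by rewrite ltr_pM2l.
have : (u a j - u b j) * u c i <= (u a j - u b j) * ((1 - t) * u a i + t * u b i).
  by rewrite ler_wpM2l// ltW.
lra.
Qed.

(** Let [c] be the last action of [[a, b]] reaching the mixture [w] in all states where [a] does. If
    [c] fell short in another state [i], so would a slightly larger [y]; being beyond [c], this [y]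
    also falls short in some state where [a] does not, which [pair_crossing] excludes. *)
Let dominance_le a b t : al <= a -> a <= b -> b <= ar -> 0 <= t <= 1 ->
  exists2 c, al <= c <= ar & forall i, (1 - t) * u a i + t * u b i <= u c i.
Proof.
move=> ala ab bar t01; have /andP[t0 t1] := t01.
pose w i : R := (1 - t) * u a i + t * u b i.
pose S := [set c | a <= c <= b /\ forall i, w i <= u a i -> w i <= u c i].
have Sa : S a by split=> //; rewrite lexx.
have Sub : ubound S b by move=> c [/andP[]].
have hS : has_sup S by split; [exists a|exists b].
pose c := sup S.
have ac : a <= c by apply: ub_le_sup => //; exists b.
have cb : c <= b by apply: ge_sup => //; exists a.
have alcar : al <= c <= ar by apply/andP; split; lra.
have near_lt i : u c i < w i -> exists2 e : R, 0 < e &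
    forall y, `|c - y| < e -> u y i < w i.
  move=> ci; have /cvgr_lt/(_ _ ci)/nbhs_ballP[e e0 He]   := @uc i c alcar.
  by exists e => // y; exact: He.
have Pc i : w i <= u a i -> w i <= u c i.
  move=> wa; rewrite leNgt; apply/negP => /near_lt[e e0 He].
  have [y Sy] := sup_adherent e0 hS; rewrite -/c => cy.
  have yc : y <= c by apply: ub_le_sup => //; exists b.
  have : u y i < w i by apply: He; rewrite ltr_norml; apply/andP; split; lra.
  by rewrite ltNge (proj2 Sy i wa).
exists c => // i; rewrite -/(w i).
have [wa|aw] := leP (w i) (u a i); first exact: Pc.
rewrite leNgt; apply/negP => ci; have [e e0 He] := near_lt i ci.
have bw : w i <= u b i.
  have : t * (u a i - u b i) < 0 by move: aw; rewrite /w; lra.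
  move=> h; have : u a i < u b i.
    by rewrite ltNge; apply: contraTN h => h; rewrite -leNgt mulr_ge0// subr_ge0.
  move=> h'; rewrite /w -subr_ge0.
  have -> : u b i - ((1 - t) * u a i + t * u b i) = (1 - t) * (u b i - u a i) by ring.
  by rewrite mulr_ge0; lra.
have cltb : c < b.
  rewrite lt_neqAle cb andbT; apply/eqP => cbE.
  by move: ci; rewrite cbE ltNge bw.
pose y := Num.min b (c + e / 2).
have cy : c < y by rewrite lt_min cltb ltrDl divr_gt0.
have yb : y <= b by rewrite ge_min lexx.
have ye : y <= c + e / 2 by rewrite ge_min lexx orbT.
have yi : u y i < w i by apply: He; rewrite ltr_norml; apply/andP; split; lra.
have [j [wj yj]] : exists j, w j <= u a j /\ u y j < w j.
  apply: contrapT => /forallNP H.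
  have : S y.
    split; first by apply/andP; split; lra.
    by move=> j wj; rewrite leNgt; apply/negP => yj; exact: (H j).
  by move=> Sy; have : y <= c by [apply: ub_le_sup => //; exists b]; rewrite leNgt cy.
have := @pair_crossing a b y i j t ala bar _ yb t01 wj aw yj.
rewrite -/(w i) => H; move: yi; rewrite ltNge H//; lra.
Qed.

Lemma pure_dominance a b t : al <= a <= ar -> al <= b <= ar -> 0 <= t <= 1 ->
  exists2 c, al <= c <= ar & forall i, (1 - t) * u a i + t * u b i <= u c i.
Proof.
move=> /andP[ala aar] /andP[alb bar] t01; have [ab|/ltW ba] := leP a b.
  exact: dominance_le.
have [|c cA H] := @dominance_le b a (1 - t) alb ba aar _.
  by apply/andP; split; lra.
by exists c => // i; have := H i; lra.
Qed.
End pure_dominance.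

(** * Limits superior of sequences of actions *)

Section limsup.
Context {R : realType}.

Lemma limn_sup_close (a : nat -> R) al ar : (forall k, al <= a k <= ar) ->
  forall e, 0 < e -> forall K, exists2 k, (K <= k)%N & `|a k - limn_sup a| < e.
Proof.
move=> aA e e0 K.
have hub : has_ubound (range a).
  by exists ar => _ [k _ <-]; case/andP: (aA k).
have hlb : has_lbound (range a).
  by exists al => _ [k _ <-]; case/andP: (aA k).
have e20 : 0 < e / 2 by rewrite divr_gt0.
have cs : sups a @ \oo --> limn_sup a.
  by have h := cvg_sups_inf hub hlb; apply: cvgP h.
have /cvgrPdist_lt/(_ _ e20)[N _ HN] := cs.
pose m := maxn N K.
have /= sm := HN m (leq_maxl N K).
have hs : has_sup (sdrop a m).
  split; first by exists (a m), m => /=.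
  by exists ar => _ [k _ <-]; case/andP: (aA k).
have [_ [k /= mk <-] ak] := sup_adherent e20 hs.
have ks : a k <= sup (sdrop a m) by apply: ub_le_sup; [case: hs|exists k].
exists k; first exact: leq_trans (leq_maxr N K) mk.
move: sm ak ks; rewrite /sups /= !ltr_norml => /andP[s1 s2] ak ks.
by apply/andP; split; lra.
Qed.

Lemma limn_sup_segment (a : nat -> R) al ar : (forall k, al <= a k <= ar) ->
  al <= limn_sup a <= ar.
Proof.
move=> aA; apply/andP; split; rewrite leNgt; apply/negP => h.
  have e0 : 0 < al - limn_sup a by lra.
  have [k _] := limn_sup_close aA e0 0%N.
  by rewrite ltr_norml => /andP[_]; have /andP[] := aA k; lra.
have e0 : 0 < limn_sup a - ar by lra.
have [k _] := limn_sup_close aA e0 0%N.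
by rewrite ltr_norml => /andP[+ _]; have /andP[] := aA k; lra.
Qed.

(** The limit superior is a cluster point of the actions, so continuity of [F] passes the bound to
    it. Unlike the limit of a subsequence chosen signal by signal, it depends measurably on the
    signal. *)
Lemma le_limn_sup_comp (a v : nat -> R) (F : R -> R) al ar l :
  (forall k, al <= a k <= ar) -> {for limn_sup a, continuous F} ->
  v @ \oo --> l -> (forall k, v k <= F (a k)) -> l <= F (limn_sup a).
Proof.
move=> aA Fc vl vF; rewrite leNgt; apply/negP => Fl.
pose z := (F (limn_sup a) + l) / 2.
have Fz : F (limn_sup a) < z by rewrite /z; lra.
have zl : z < l by rewrite /z; lra.
have /cvgr_lt/(_ _ Fz)/nbhs_ballP[e e0 He] := Fc.
have /cvgr_gt/(_ _ zl)[N _ HN] := vl.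
have [k Nk ak] := limn_sup_close aA e0 N.
have := HN k Nk; have := He (a k); rewrite /ball /= distrC => /(_ ak).
have := vF k; lra.
Qed.
End limsup.

(** * Measurable choices coded by natural numbers *)

Section countable_codes.
Context d (T : measurableType d).

(** The preimage of any set is a countable union over the pairs of values of [j] and [j']. *)
Lemma measurable_fun_nat2 (j j' : T -> nat) (F : nat -> nat -> nat) :
  measurable_fun setT j -> measurable_fun setT j' ->
  measurable_fun setT (fun x => F (j x) (j' x)).
Proof.
move=> mj mj' _ Y _; rewrite setTI.
rewrite [X in measurable X](_ : _ = \bigcup_k \bigcup_(l in [set l | Y (F k l)])
    ((j @^-1` [set k]) `&` (j' @^-1` [set l]))).
  apply: bigcup_measurable => k _; apply: bigcup_measurable => l _.
  by apply: measurableI; rewrite -[X in measurable X]setTI; [exact: mj|exact: mj'].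
apply/seteqP; split=> x /=; first by move=> Yx; exists (j x) => //; exists (j' x).
by move=> [k _ [l /= Ykl [-> ->]]].
Qed.

Lemma measurable_mem (G : set T) : measurable G ->
  measurable_fun setT (fun x => x \in G).
Proof.
move=> mG; apply: (measurable_fun_bool true); rewrite setTI.
rewrite [X in measurable X](_ : _ = G)//.
by apply/seteqP; split=> x /= => [/set_mem|/mem_set].
Qed.
End countable_codes.

(** Ties go to the smallest index. An index is returned instead of an action so that the selection
    factors through [nat]. *)
Fixpoint argmaxs {R : realType} (phi : R -> R) a s : nat :=
  if s is b :: s' then
    if maxs phi b s' <= phi a then 0%N else (argmaxs phi b s').+1
  else 0%N.

Lemma argmaxs_size {R : realType} (phi : R -> R) a s :
  (argmaxs phi a s < size (a :: s))%N.
Proof. by elim: s a => [|b s ih] a //=; case: ifP => // _; exact: ih. Qed.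

Lemma nth_argmaxs {R : realType} (phi : R -> R) a s :
  phi (nth a (a :: s) (argmaxs phi a s)) = maxs phi a s.
Proof.
elim: s a => [|b s ih] a //=; have [//|h] := leP (maxs phi b s) (phi a).
rewrite -ih; congr phi.
by apply: set_nth_default; exact: argmaxs_size.
Qed.

Lemma measurable_argmaxs d (T : measurableType d) {R : realType}
    (phi : T -> R -> R) a s :
  (forall b, measurable_fun setT (phi ^~ b)) ->
  measurable_fun setT (fun x => argmaxs (phi x) a s).
Proof.
move=> mphi; elim: s a => [|b s ih] a /=; first exact: measurable_cst.
have mmax c r : measurable_fun setT (fun x => maxs (phi x) c r).
  by elim: r c => [|c' r ihr] c //=; exact: measurable_maxr.
apply: measurable_fun_ifT; first exact: measurable_fun_ler.
  exact: measurable_cst.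
exact: (measurable_fun_nat2 (fun k _ => k.+1) (ih b) (ih b)).
Qed.

(** * Strategies *)

Section restriction.
Context {R : realType} {n : nat}.
Variables (lo hi : R) (f : 'I_n.+1 -> R -> R).
Local Notation mu := (@lebesgue_measure R).
Local Notation D := (`[lo, hi]%classic : set R).

(** Extension by zero puts both experiments on the whole line, so that the general results over one
    measure space apply to them. *)
Definition extend0 : 'I_n.+1 -> R -> R := fun i => f i \_ D.

Lemma extend0_in x : D x -> forall i, extend0 i x = f i x.
Proof. by move=> Dx i; rewrite /extend0 patchT// mem_set. Qed.

Lemma extend0_out x : ~ D x -> forall i, extend0 i x = 0.
Proof. by move=> Dx i; rewrite /extend0 patchN//; apply/negP => /set_mem. Qed.

Lemma extend0_density : is_experiment lo hi f ->
  forall i, is_density mu (extend0 i).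
Proof.
move=> [_ Hf] i; have [mf f0 f1] := Hf i; split.
- by apply/(measurable_restrictT _ _).1 => //; exact: measurable_itv.
- move=> x; have [Dx|Dx] := pselect (D x); first by rewrite extend0_in// f0.
  by rewrite extend0_out.
- by rewrite -f1 [RHS]integral_mkcond restrict_EFin.
Qed.

Lemma mixdens_out q x : ~ D x -> mixdens extend0 q x = 0.
Proof. by move=> Dx; rewrite /mixdens big1// => i _; rewrite extend0_out// mulr0. Qed.

Lemma post_expect_extend0 q h : post_expect lo hi f q h =
  (\int[mu]_x (mixdens extend0 q x * h (posterior extend0 q x))%:E)%E.
Proof.
rewrite /post_expect integral_mkcond; apply: eq_integral => x _.
have [Dx|Dx] := pselect (D x); last first.
  by rewrite patchN ?mixdens_out ?mul0r//; apply/negP => /set_mem.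
rewrite patchT ?mem_set//.
have E : mixdens extend0 q x = mixdens f q x.
  by apply: eq_bigr => i _; rewrite extend0_in.
rewrite E; congr (_ * h _)%:E; apply/funext => i.
by rewrite /posterior E extend0_in.
Qed.
End restriction.

(** * Mean utilities of mixed strategies *)

Section strategy_means.
Context {R : realType} {n : nat}.
Variables (A : set R) (u : R -> 'I_n.+1 -> R).
Hypothesis dA : decision_problem A u.
Implicit Types (sigma : R.-pker R ~> R).

Definition strat_mean sigma i x : R := \int[sigma x]_(a in A) u a i.

Let mA : measurable A := decision_problem_measurable dA.
Let measurable_u i : measurable_fun A (u ^~ i) := decision_problem_measurable_fun i dA.

Let sigmaA_le1 sigma x : (sigma x A <= 1)%E.
Proof.
apply: le_trans (sprob_kernel_le1 sigma x).
by apply: le_measure => //; exact: mem_set.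
Qed.

Let integrable_u sigma i x : (sigma x).-integrable A (EFin \o u ^~ i).
Proof.
have [M uM] := decision_problem_bounded dA.
apply: measurable_bounded_integrable => //.
  by rewrite (le_lt_trans (sigmaA_le1 _ _))// ltry.
exists M; split; first exact: num_real.
by move=> y My a Aa; apply: le_trans (uM _ _ Aa) (ltW My).
Qed.

Lemma strat_meanE sigma i x :
  (\int[sigma x]_(a in A) (u a i)%:E = (strat_mean sigma i x)%:E)%E.
Proof. by rewrite fineK//; exact: (integrable_fin_num mA (integrable_u sigma i x)). Qed.

Let fin_sigmaA sigma x : sigma x A \is a fin_num.
Proof.
by rewrite ge0_fin_numE// (le_lt_trans (sigmaA_le1 _ _))// ltry.
Qed.

(** When [M] bounds the utilities, the shifted integrand is nonnegative, which is the form used for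
    measurability of kernel integrals. *)
Lemma strat_mean_shift (M : R) sigma i x : strat_mean sigma i x =
  fine (\int[sigma x]_a (((fun a => u a i + M) \_ A) a)%:E)%E - M * fine (sigma x A).
Proof.
have iM : (sigma x).-integrable A (EFin \o cst M).
  apply: measurable_bounded_integrable => //.
    by rewrite (le_lt_trans (sigmaA_le1 _ _))// ltry.
  exists `|M|; split; first exact: num_real.
  by move=> y My a Aa; exact: ltW.
rewrite -/(Rintegral (sigma x) setT _) -Rintegral_mkcond RintegralD//.
by rewrite (Rintegral_cst (sigma x) mA) addrK.
Qed.

Lemma bounded_measurable_strat_mean sigma i : bounded_measurable (strat_mean sigma i).
Proof.
have [M uM] := decision_problem_bounded dA; split; last first.
  exists `|M| => x.
  apply: le_trans (le_normr_Rintegral mA (integrable_u sigma i x)) _.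
  apply: (@le_trans _ _ (\int[sigma x]_(a in A) `|M|)).
    apply: le_Rintegral => //.
    - by have := integrable_norm (integrable_u sigma i x).
    - apply: measurable_bounded_integrable => //.
        by rewrite (le_lt_trans (sigmaA_le1 _ _))// ltry.
      exists `|M|; split; first exact: num_real.
      by move=> y My a Aa; rewrite normr_id; exact: ltW.
    by move=> a Aa; apply: le_trans (uM _ _ Aa) (ler_norm _).
  rewrite Rintegral_cst// ler_piMr// -lee_fin fineK//; exact: sigmaA_le1.
rewrite (funext (strat_mean_shift M sigma i)).
apply: measurable_funB; last first.
  apply: measurable_funM; first exact: measurable_cst.
  apply: measurableT_comp; first exact: fine_measurable.
  exact: measurable_kernel.
apply: measurableT_comp; first exact: fine_measurable.
apply: measurable_fun_integral_kernel.
- by move=> U mU; exact: measurable_kernel.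
- move=> a; rewrite lee_fin /patch; case: ifPn => [/set_mem Aa|//].
  by have := uM a i Aa; rewrite ler_norml => /andP[]; lra.
- apply/measurable_EFinP/(measurable_restrictT _ _).1 => //.
  by apply: measurable_funD => //; exact: measurable_cst.
Qed.

Lemma strat_mean_le sigma x (c : 'I_n.+1 -> R) K : sigma x A = 1%E ->
  (forall a, A a -> score u c a <= K) ->
  \sum_i c i * strat_mean sigma i x <= K.
Proof.
move=> sA cK.
have iu i : (sigma x).-integrable setT (EFin \o ((u ^~ i) \_ A)).
  by rewrite -restrict_EFin; apply/(integrable_mkcond _ _).1 => //; exact: integrable_u.
have iK : (sigma x).-integrable A (EFin \o cst K).
  apply: measurable_bounded_integrable => //; first by rewrite sA ltry.
  exists `|K|; split; first exact: num_real.
  by move=> y Ky a Aa; exact: ltW.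
have -> : \sum_i c i * strat_mean sigma i x =
    \int[sigma x]_a (\sum_i c i * ((u ^~ i) \_ A) a).
  rewrite Rintegral_sum; last by move=> i; exact: integrableZl_EFin.
  apply: eq_bigr => i _; rewrite RintegralZl//.
  by rewrite /strat_mean Rintegral_mkcond.
have -> : K = \int[sigma x]_a (((cst K) \_ A) a).
  by rewrite -Rintegral_mkcond Rintegral_cst// sA mulr1.
apply: le_Rintegral => //.
- by apply: integrable_sum_EFin => i; exact: integrableZl_EFin.
- by rewrite -restrict_EFin; apply/(integrable_mkcond _ _).1.
move=> a _; rewrite /patch; case: ifPn => [/set_mem Aa|_]; first exact: cK.
by rewrite big1// => i _; rewrite mulr0.
Qed.

Lemma strat_payoffE lo hi (f : 'I_n.+1 -> R -> R) sigma i :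
  is_experiment lo hi f ->
  strat_payoff lo hi f A u sigma i =
  (\int[lebesgue_measure]_x (strat_mean sigma i x * extend0 lo hi f i x))%:E.
Proof.
move=> ef; rewrite /strat_payoff; under eq_integral do rewrite strat_meanE -EFinM.
rewrite integral_mkcond restrict_EFin -integral_Rintegral; last first.
  apply: bounded_measurable_integrable; first exact: extend0_density.
  exact: bounded_measurable_strat_mean.
apply: eq_integral => x _; congr EFin; rewrite /extend0 /patch.
by case: ifP => // _; rewrite mulr0.
Qed.

(** Signal by signal, a mixed action scores no more than the best action; replacing the latter by a
    net point costs [e] times the mixture density, which integrates to one. *)
Lemma strat_payoff_le_maxs lo hi (f : 'I_n.+1 -> R -> R) sigma (l : 'I_n.+1 -> R) a s e :
  is_experiment lo hi f -> is_strategy lo hi A sigma -> simplex l -> 0 <= e ->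
  (forall a', A a' -> exists2 b, b \in a :: s & forall i, `|u a' i - u b i| <= e) ->
  \sum_i l i * (\int[lebesgue_measure]_x
      (strat_mean sigma i x * extend0 lo hi f i x)) - e <=
  \int[lebesgue_measure]_x
      maxs (score u (fun i => l i * extend0 lo hi f i x)) a s.
Proof.
move=> ef ss [l0 l1] e0 H; pose F := extend0 lo hi f.
have dF i : is_density lebesgue_measure (F i) by exact: extend0_density.
have iF i : (lebesgue_measure).-integrable setT
    (EFin \o (fun x => strat_mean sigma i x * F i x)).
  apply: bounded_measurable_integrable => //.
  exact: bounded_measurable_strat_mean.
have il i : (lebesgue_measure).-integrable setT (EFin \o (fun x => l i * F i x)).
  exact/integrableZl_EFin/is_density_integrable.
have -> : \sum_i l i * (\int[lebesgue_measure]_x (strat_mean sigma i x * F i x)) - e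
  = \int[lebesgue_measure]_x (\sum_i l i * (strat_mean sigma i x * F i x)
     - e * \sum_i l i * F i x).
  rewrite RintegralB//; last 2 first.
  - by apply: integrable_sum_EFin => i; exact: integrableZl_EFin.
  - by apply: integrableZl_EFin; exact: integrable_sum_EFin.
  rewrite Rintegral_sum; last by move=> i; exact: integrableZl_EFin.
  rewrite RintegralZl//; last exact: integrable_sum_EFin.
  rewrite Rintegral_sum//; congr (_ - _).
    by apply: eq_bigr => i _; rewrite RintegralZl.
  rewrite (eq_bigr l) ?l1 ?mulr1// => i _.
  rewrite RintegralZl ?Rintegral_density ?mulr1//; exact: is_density_integrable.
apply: le_Rintegral => //.
- apply: integrableB_EFin.
    by apply: integrable_sum_EFin => i; exact: integrableZl_EFin.
  by apply: integrableZl_EFin; exact: integrable_sum_EFin.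
- exact: integrable_maxs.
move=> x _; have [Dx|Dx] := pselect (`[lo, hi]%classic x); last first.
  rewrite !big1 ?mulr0 ?subr0; last 2 first.
  - by move=> i _; rewrite /F extend0_out// mulr0.
  - by move=> i _; rewrite /F extend0_out// !mulr0.
  have [b _ ->] := maxs_mem (score u (fun i => l i * extend0 lo hi f i x)) a s.
  by rewrite /score big1// => i _; rewrite extend0_out// mulr0 mul0r.
rewrite lerBlDr.
under eq_bigr do rewrite mulrCA mulrC.
apply: strat_mean_le; first exact: ss.
move=> b /H[b' b's bb'].
apply: (@le_trans _ _ (score u (fun i => l i * F i x) b' + e * \sum_i l i * F i x)).
  rewrite /score mulr_sumr -big_split /=; apply: ler_sum => i _.
  rewrite [e * _]mulrC -mulrDr ler_wpM2l//.
    by rewrite mulr_ge0//; case: (dF i).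
  by rewrite -lerBlDl; exact: le_trans (ler_norm _) (bb' i).
by rewrite lerD2r; exact: maxs_ge.
Qed.
End strategy_means.

(** * Kernels of finite mixtures *)

Section mixture_kernel.
Context {R : realType} (m : nat) (b : nat -> R) (p : nat -> R -> R).
Hypothesis mp : forall k, measurable_fun setT (p k).
Hypothesis p0 : forall k x, 0 <= p k x.
Hypothesis p1 : forall x, \sum_(k < m) p k x = 1.

(** The proofs of measurability and of total mass one are arguments of the term, so that the kernel
    and probability instances can be attached to it. *)
Definition mixture of (forall k, measurable_fun setT (p k)) &
    (forall x, \sum_(k < m) p k x = 1) : R -> {measure set R -> \bar R} :=
  fun x => msum (fun k => mscale (NngNum (p0 k x)) (dirac (b k))) m.

Local Notation mix := (mixture mp p1).

Lemma mixtureE x (U : set R) :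
  mix x U = (\sum_(k < m) (p k x)%:E * \d_(b k) U)%E.
Proof. by []. Qed.

Let measurable_mixture U : measurable U -> measurable_fun [set: R] (mix ^~ U).
Proof.
move=> mU; rewrite (_ : mix ^~ U =
    fun x => (\sum_(k < m) p k x * (\1_U (b k) : R))%:E); last first.
  by apply/funext => x; rewrite mixtureE -sumEFin.
by apply/measurable_EFinP; apply: measurable_sum => k; exact: measurable_funM.
Qed.

HB.instance Definition _ := isKernel.Build _ _ _ _ R mix measurable_mixture.

Let mixture_prob x : mix x [set: R] = 1%E.
Proof.
rewrite mixtureE; under eq_bigr do rewrite diracT mule1.
by rewrite sumEFin p1.
Qed.

HB.instance Definition _ := Kernel_isProbability.Build _ _ _ _ R mix mixture_prob.

Definition mixture_pker : R.-pker R ~> R := mix.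

Lemma mixture_pker_mass (A : set R) x : (forall k, (k < m)%N -> A (b k)) ->
  mixture_pker x A = 1%E.
Proof.
move=> bA; rewrite -(mixture_prob x) /mixture_pker /= !mixtureE.
by apply: eq_bigr => k _; rewrite !diracE !mem_set//; exact: bA.
Qed.

Lemma mixture_ge0_integral (A : set R) (h : R -> R) x : measurable A ->
  measurable_fun A h -> (forall a, A a -> 0 <= h a) ->
  (forall k, (k < m)%N -> A (b k)) ->
  (\int[mixture_pker x]_(a in A) (h a)%:E = (\sum_(k < m) p k x * h (b k))%:E)%E.
Proof.
move=> mA mh h0 bA; rewrite /mixture_pker /= /mixture.
rewrite ge0_integral_measure_sum//; last exact/measurable_EFinP.
rewrite -sumEFin; apply: eq_bigr => k _.
rewrite ge0_integral_mscale//; last exact/measurable_EFinP.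
rewrite integral_dirac//; last exact/measurable_EFinP.
by rewrite diracE mem_set ?mul1e//; exact: bA.
Qed.
End mixture_kernel.

(** * Best replies within a finite net *)

Section optimal_choice.
Context {R : realType} {n : nat}.
Local Notation mu := (@lebesgue_measure R).
Variables (A : set R) (u : R -> 'I_n.+1 -> R).
Hypothesis dA : decision_problem A u.
Variables (F : 'I_n.+1 -> R -> R) (l : 'I_n.+1 -> R) (a : R) (s : seq R).
Hypothesis dF : forall i, is_density mu (F i).
Hypothesis sA : [set` a :: s] `<=` A.

Definition best_index x := argmaxs (score u (fun i => l i * F i x)) a s.
Definition best x := nth a (a :: s) (best_index x).

Lemma nth_in k : A (nth a (a :: s) k).
Proof.
apply: sA => /=; have [ks|ks] := ltnP k (size (a :: s)); first exact: mem_nth.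
by rewrite nth_default// in_cons eqxx.
Qed.

Lemma measurable_best_index : measurable_fun setT best_index.
Proof.
apply: measurable_argmaxs => b; apply: measurable_sum => i.
apply: measurable_funM; last exact: measurable_cst.
by apply: measurable_funM; [exact: measurable_cst|case: (dF i)].
Qed.

Lemma bounded_measurable_best (K : R) (k : R -> R) :
  (forall b, A b -> `|k b| <= K) -> bounded_measurable (k \o best).
Proof.
move=> kK; apply: (@bounded_measurable_comp _ _ _ (k \o nth a (a :: s)) best_index).
  exact: measurable_best_index.
by move=> r; apply/kK/nth_in.
Qed.

Lemma Rintegral_best :
  \sum_i l i * \int[mu]_x (u (best x) i * F i x) =
  \int[mu]_x maxs (score u (fun i => l i * F i x)) a s.
Proof.
have [M uM] := decision_problem_bounded dA.
have iu i : mu.-integrable setT (EFin \o (fun x => u (best x) i * F i x)).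
  apply: bounded_measurable_integrable => //.
  by apply: (@bounded_measurable_best M (u ^~ i)) => b; exact: uM.
rewrite (eq_bigr (fun i => \int[mu]_x (l i * (u (best x) i * F i x)))); last first.
  by move=> i _; rewrite RintegralZl.
rewrite -Rintegral_sum; last by move=> i; exact: integrableZl_EFin.
apply: eq_Rintegral => x _; rewrite -nth_argmaxs -/(best x) /score.
by apply: eq_bigr => i _; rewrite mulrCA mulrC.
Qed.
End optimal_choice.

(** * Strategies under [F] matching a given strategy under [G] *)

Section attaining_strategy.
Context {R : realType} {n : nat}.
Local Notation mu := (@lebesgue_measure R).
Variables (xl xr yl yr : R) (f g : 'I_n.+1 -> R -> R).
Hypothesis ef : is_experiment xl xr f.
Hypothesis eg : is_experiment yl yr g.
Hypothesis gf : zonoid_le mu (extend0 yl yr g) (extend0 xl xr f).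
Let F := extend0 xl xr f.
Let G := extend0 yl yr g.
Let dF i : is_density mu (F i) := extend0_density ef i.
Let dG i : is_density mu (G i) := extend0_density eg i.
Variables (A : set R) (u : R -> 'I_n.+1 -> R) (sigmaG : R.-pker R ~> R).
Hypothesis dA : decision_problem A u.
Hypothesis qA : QCC A u.
Hypothesis ssG : is_strategy yl yr A sigmaG.

Let w i := \int[mu]_x (strat_mean A u sigmaG i x * G i x).

(** Supplies the optimality hypothesis of [payoff_attained]: the payoff of [sigmaG] is bounded by
    the value of a finite net, the zonoid order moves this value to [F], and the best reply attains
    it. *)
Lemma near_optimal_reply l e : simplex l -> 0 < e ->
  exists a s, [set` a :: s] `<=` A /\
  \sum_i l i * w i - e <=
  \sum_i l i * \int[mu]_x (u (best u F l a s x) i * F i x).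
Proof.
move=> hl e0; have [a [s [pas sA H]]] := decision_problem_net dA e0.
exists a, s; split=> //; rewrite (Rintegral_best dA l dF sA).
apply: le_trans (strat_payoff_le_maxs dA eg ssG hl (ltW e0) H) _.
apply: zonoid_le_maxs => //; last by case: hl.
exact: QCC_subset qA.
Qed.

(** Vectors of mixing probabilities are stable under pointwise limits, so the limit given by
    [payoff_attained] is again a mixed strategy. *)
Lemma finite_attaining : finite_set A ->
  exists sigmaF : R.-pker R ~> R, (forall x, sigmaF x A = 1%E) /\
    forall i, w i <= \int[mu]_x (strat_mean A u sigmaF i x * F i x).
Proof.
move=> /finite_seqP[t At].
have [a0 Aa0] := decision_problem_neq0 dA.
have t0 : (0 < size t)%N by move: Aa0; rewrite At /=; case: (t).
have [m tm] : exists m, size t = m.+1 by exists (size t).-1; rewrite prednK.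
pose b k := nth 0 t k.
have bA k : (k < m.+1)%N -> A (b k) by move=> km; rewrite At /= mem_nth// tm.
pose V (v : R -> 'I_m.+1 -> R) := [/\ forall j, measurable_fun setT (v ^~ j),
  forall x j, 0 <= v x j & forall x, \sum_j v x j = 1].
have Vbnd v : V v -> forall x j, `|v x j| <= 1.
  move=> [_ v0 v1] x j; rewrite ger0_norm// -(v1 x) (bigD1 j)//= lerDl.
  exact: sumr_ge0.
pose c i (j : 'I_m.+1) := u (b j) i.
have [||||v_ [v [Vv v_v wv]]] := @payoff_attained _ _ _ mu n m.+1 F c V 1 w dF _ Vbnd.
- by move=> v [].
- move=> v v' r [mv v0 v1] [mv' v'0 v'1] /andP[r0 r1]; split=> [j|x j|x].
  + by apply: measurable_funD; apply: measurable_funM => //; exact: measurable_cst.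
  + by rewrite addr_ge0// mulr_ge0// subr_ge0.
  + by rewrite big_split /= -!mulr_sumr v1 v'1; ring.
- move=> v v' U [mv v0 v1] [mv' v'0 v'1] mU; split=> [j|x j|x]; last 2 first.
  + by case: ifP.
  + by case: ifP.
  + rewrite (_ : (fun x => _) = fun x => if x \in U then v x j else v' x j).
      by apply: measurable_fun_ifT => //; exact: measurable_mem.
    by apply/funext => x; case: ifP.
- move=> l hl e e0; have [a [s [sA H]]] := near_optimal_reply hl e0.
  have bt x : best u F l a s x \in t by move: (nth_in sA (best_index u F l a s x)); rewrite At.
  (* The pure best reply as a degenerate mixture: all mass on its position in [t]. *)
  exists (fun x j => (index (best u F l a s x) t == j :> nat)%:R).
    split=> [j|x j|x]; last 2 first.
    + exact: ler0n.
    + have it : (index (best u F l a s x) t < m.+1)%N by rewrite -tm index_mem.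
      rewrite (bigD1 (Ordinal it))//= eqxx big1 ?addr0// => j /eqP ji.
      by case: eqP => // E; case: ji; exact/val_inj.
    have [] // := @bounded_measurable_best _ _ A u F l a s dF sA 1
      (fun y => (index y t == j :> nat)%:R).
    by move=> y _; case: (_ == _); rewrite ?normr1 ?normr0.
  apply: (le_trans H); rewrite le_eqVlt; apply/orP; left; apply/eqP.
  apply: eq_bigr => i _; congr (_ * _); apply: eq_Rintegral => x _.
  congr (_ * _).
  have it : (index (best u F l a s x) t < m.+1)%N by rewrite -tm index_mem.
  rewrite (bigD1 (Ordinal it))//= eqxx mulr1 /c /b nth_index// big1 ?addr0// => j /eqP ji.
  by case: eqP => [E|_]; [case: ji; apply/val_inj|rewrite mulr0].
have Vlim : V v.
  split=> [j|x j|x].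
  - apply: (@measurable_fun_cvg _ _ _ _ (fun k x => v_ k x j)) => [k|x _].
      by have [mvk _ _] := Vv k; exact: mvk.
    exact: v_v.
  - apply: (cvgr_to_ge (v_v x j)); apply: nearW => k.
    by have [_ vk0 _] := Vv k; exact: vk0.
  - have := cvg_sumR (s := index_enum 'I_m.+1) (v_v x).
    have -> : (fun k => \sum_j v_ k x j) = fun=> 1.
      by apply/funext => k; have [_ _ vk1] := Vv k; exact: vk1.
    by move=> /cvg_lim <- //; rewrite lim_cst.
have [mv v0 v1] := Vlim.
(* [mixture] takes weights indexed by [nat]; the default that [inord] returns above [m] is never
   read by a sum over [k < m.+1]. *)
pose p k x := v x (inord k : 'I_m.+1).
have p1 x : \sum_(k < m.+1) p k x = 1.
  by rewrite -(v1 x); apply: eq_bigr => j _; rewrite /p inord_val.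
have mp k : measurable_fun setT (p k) by exact: mv.
have p0 k x : 0 <= p k x by exact: v0.
pose sF := mixture_pker b mp p0 p1.
have sF1 x : sF x A = 1%E by exact: mixture_pker_mass.
exists sF; split=> // i; apply: (le_trans (wv i)).
rewrite le_eqVlt; apply/orP; left; apply/eqP.
apply: eq_Rintegral => x _; congr (_ * _).
have [M uM] := decision_problem_bounded dA.
rewrite (strat_mean_shift dA M) sF1 mulr1.
have -> : (\int[sF x]_a (((fun a => u a i + M) \_ A) a)%:E =
    \int[sF x]_(a in A) (u a i + M)%:E)%E.
  by rewrite [RHS]integral_mkcond restrict_EFin.
rewrite /sF mixture_ge0_integral//; last 3 first.
- exact: decision_problem_measurable dA.
- apply: measurable_funD; last exact: measurable_cst.
  exact: decision_problem_measurable_fun dA.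
- by move=> y Ay; have := uM y i Ay; rewrite ler_norml => /andP[]; lra.
rewrite [fine _](_ : _ = \sum_(k < m.+1) (p k x * u (b k) i + p k x * M)); last first.
  by apply: eq_bigr => k _; rewrite mulrDr.
rewrite big_split /= -mulr_suml p1 mul1r addrK.
by apply: eq_bigr => j _; rewrite /c /p inord_val mulrC.
Qed.

Lemma segment_attaining al ar : al <= ar -> A = `[al, ar]%classic ->
  (forall i a, `[al, ar]%classic a -> derivable (u ^~ i) a 1) ->
  exists sigmaF : R.-pker R ~> R, (forall x, sigmaF x A = 1%E) /\
    forall i, w i <= \int[mu]_x (strat_mean A u sigmaF i x * F i x).
Proof.
move=> alr AE du.
have uc i y : al <= y <= ar -> {for y, continuous (u ^~ i)}.
  by move=> yA; apply/derivable_continuous1/du; rewrite /= in_itv.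
have inA y : A y <-> al <= y <= ar by rewrite AE /= in_itv.
have [M uM] := decision_problem_bounded dA.
(* Payoff profiles dominated by a pure strategy. The pure strategy factors
   through [nat], so that choosing a dominating action for a pair of actions
   ([pure_dominance]) preserves measurability. *)
pose V (v : R -> 'I_n.+1 -> R) := [/\ forall j, measurable_fun setT (v ^~ j),
  forall x j, `|v x j| <= M & exists jp : (R -> nat) * (nat -> R),
  [/\ measurable_fun setT jp.1, forall k, al <= jp.2 k <= ar &
      forall x i, v x i <= u (jp.2 (jp.1 x)) i]].
pose c (i j : 'I_n.+1) : R := (i == j)%:R.
have cE i (y : 'I_n.+1 -> R) : \sum_j c i j * y j = y i.
  rewrite (bigD1 i)//= /c eqxx mul1r big1 ?addr0// => j ji.
  by rewrite eq_sym (negbTE ji) mul0r.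
have Vbnd v : V v -> forall x j, `|v x j| <= M by case.
have [||||v_ [v [Vv v_v wv]]] := @payoff_attained _ _ _ mu n n.+1 F c V M w dF _ Vbnd.
- by move=> v [].
- move=> v v' r [mv vM [[j p] /= [mj pA vp]]] [mv' v'M [[j' p'] /= [mj' p'A v'p]]] r01.
  have /andP[r0 r1] := r01.
  split=> [i|x i|].
  + by apply: measurable_funD; apply: measurable_funM => //; exact: measurable_cst.
  + apply: le_trans (ler_normD _ _) _; rewrite !normrM.
    rewrite (ger0_norm r0) (ger0_norm (_ : 0 <= 1 - r)) ?subr_ge0//.
    have := ler_wpM2l r0 (v'M x i).
    have r1' : 0 <= 1 - r by rewrite subr_ge0.
    by have := ler_wpM2l r1' (vM x i); lra.
  have qc : QCC `[al, ar]%classic u by rewrite -AE.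
  have /choice[h hP] : forall kl : nat * nat, exists y, al <= y <= ar /\
      forall i, (1 - r) * u (p kl.1) i + r * u (p' kl.2) i <= u y i.
    move=> [k l]; have [y yA Hy] := pure_dominance uc qc (pA k) (p'A l) r01.
    by exists y.
  (* The pair of codes is packed into one natural number; the default [(0, 0)] only serves numbers
     that encode no pair. *)
  exists (fun x => choice.pickle (j x, j' x), fun k => h (odflt (0, 0)%N (choice.unpickle k))).
  split=> [/=|k /=|x i /=].
  + exact: (measurable_fun_nat2 (fun k l => choice.pickle (k, l)) mj mj').
  + by case: (hP (odflt (0, 0)%N (choice.unpickle k))).
  + rewrite choice.pickleK /=; have [_ /(_ i)/=] := hP (j x, j' x); apply: le_trans.
    have r1' : 0 <= 1 - r by rewrite subr_ge0.
    by rewrite lerD// ler_wpM2l.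
- move=> v v' U [mv vM [[j p] /= [mj pA vp]]] [mv' v'M [[j' p'] /= [mj' p'A v'p]]] mU.
  split=> [i|x i|].
  + rewrite (_ : (fun x => _) = fun x => if x \in U then v x i else v' x i).
      by apply: measurable_fun_ifT => //; exact: measurable_mem.
    by apply/funext => x; case: ifP.
  + by case: ifP.
  (* Even codes stand for actions of the first strategy, odd codes for those of the second. *)
  exists (fun x => if x \in U then (j x).*2 else (j' x).*2.+1,
          fun k => if odd k then p' k./2 else p k./2).
  split=> [/=|k /=|x i /=].
  + apply: measurable_fun_ifT; first exact: measurable_mem.
      exact: (measurable_fun_nat2 (fun k _ => k.*2) mj mj).
    exact: (measurable_fun_nat2 (fun k _ => k.*2.+1) mj' mj').
  + by case: ifP.
  + case: ifP => _; first by rewrite odd_double doubleK.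
    by rewrite /= odd_double /= uphalf_double.
- move=> l hl e e0; have [a [s [sA H]]] := near_optimal_reply hl e0.
  exists (fun x i => u (best u F l a s x) i).
    split=> [i|x i|].
    + by case: (@bounded_measurable_best _ _ A u F l a s dF sA M (u ^~ i)
        (fun b => uM b i)).
    + by apply: uM; exact: nth_in.
    exists (best_index u F l a s, nth a (a :: s)); split=> //=.
      exact: measurable_best_index.
    by move=> k; apply/inA; exact: nth_in.
  apply: (le_trans H); rewrite le_eqVlt; apply/orP; left; apply/eqP.
  apply: eq_bigr => i _; congr (_ * _); apply: eq_Rintegral => x _.
  by rewrite cE.
have /choice[jp jpP] : forall k, exists jp : (R -> nat) * (nat -> R),
    [/\ measurable_fun setT jp.1, forall k, al <= jp.2 k <= ar &
      forall x i, v_ k x i <= u (jp.2 (jp.1 x)) i].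
  by move=> k; have [_ _] := Vv k.
pose al_ k x := (jp k).2 ((jp k).1 x).
have al_A k x : al <= al_ k x <= ar by have [_ + _] := jpP k; apply.
(* This action is measurable in the signal and, by continuity of utilities, dominates the limit
   profile [v] in every state. *)
pose alpha x := limn_sup (al_ ^~ x).
have alphaA x : al <= alpha x <= ar by exact: limn_sup_segment.
have malpha : measurable_fun setT alpha.
  apply: measurable_fun_limn_sup => [x _|x _|k].
  - by exists ar => _ [k _ <-]; case/andP: (al_A k x).
  - by exists al => _ [k _ <-]; case/andP: (al_A k x).
  have [mj _ _] := jpP k.
  by apply: (@measurableT_comp _ _ _ _ _ _ (jp k).2 _ (jp k).1).
have v_le x i : v x i <= u (alpha x) i.
  apply: (le_limn_sup_comp (fun k => al_A k x) (uc i _ (alphaA x)) (v_v x i)).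
  by move=> k; have [_ _] := jpP k; apply.
have sE i x : strat_mean A u (kdirac malpha) i x = u (alpha x) i.
  rewrite /strat_mean /Rintegral /kdirac integral_dirac.
  - by rewrite diracE (mem_set ((inA _).2 (alphaA x)))/= mul1r.
  - exact (decision_problem_measurable dA).
  - by apply/measurable_EFinP; exact (decision_problem_measurable_fun i dA).
exists (kdirac malpha); split.
  by move=> x; rewrite /kdirac /= diracE (mem_set ((inA _).2 (alphaA x))).
move=> i; apply: (le_trans (wv i)).
apply: le_Rintegral => //.
- rewrite /comp; under eq_fun do rewrite cE.
  apply: bounded_measurable_integrable => //; split.
    by apply: (@measurable_fun_cvg _ _ _ _ (fun k x => v_ k x i)) => [k|x _];
      [have [mvk _ _] := Vv k; exact: mvk|exact: v_v].
  exists M => x; apply: (cvgr_to_le (cvg_norm (v_v x i))); apply: nearW => k.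
  by have [_ vkM _] := Vv k; exact: vkM.
- apply: bounded_measurable_integrable => //.
  exact: bounded_measurable_strat_mean.
move=> x _; rewrite cE sE ler_wpM2r//.
by case: (dF i).
Qed.

Theorem strategy_dominance : exists sigmaF : R.-pker R ~> R,
  is_strategy xl xr A sigmaF /\ forall i,
    (strat_payoff yl yr g A u sigmaG i <= strat_payoff xl xr f A u sigmaF i)%E.
Proof.
have [sigmaF [sF1 HF]] : exists sigmaF : R.-pker R ~> R,
    (forall x, sigmaF x A = 1%E) /\
    forall i, w i <= \int[mu]_x (strat_mean A u sigmaF i x * F i x).
  case: (dA) => [[fA _]|[al [ar [alr AE du]]]]; first exact: finite_attaining.
  exact: (segment_attaining alr AE du).
exists sigmaF; split; first by move=> x _; exact: sF1.
by move=> i; rewrite !strat_payoffE// lee_fin; exact: HF.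
Qed.
End attaining_strategy.

(** * The zonoid order and the three comparisons of experiments *)

Section zonoid_order.
Context {R : realType} {n : nat}.
Local Notation mu := (@lebesgue_measure R).

Definition uniform_prior : 'I_n -> R := fun=> n.+1%:R^-1.

Lemma fullb_uniform j : fullb uniform_prior j = n.+1%:R^-1.
Proof.
case: (unliftP ord0 j) => [i|] ->; first by rewrite fullb_lift.
have nz : n.+1%:R != 0 :> R by rewrite pnatr_eq0.
rewrite fullb0 /uniform_prior sumr_const card_ord.
by apply: (mulfI nz); rewrite mulrBr mulr1 mulrnAr mulfV// -natr1 addrAC subrr add0r.
Qed.

Lemma in_hsimplex_uniform : in_hsimplex uniform_prior.
Proof.
split=> [i|]; first by rewrite invr_ge0.
by rewrite -subr_ge0 -fullb0 fullb_uniform invr_ge0.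
Qed.

Section posterior_part.
Variables (lo hi : R) (f : 'I_n.+1 -> R -> R) (c : 'I_n.+1 -> R).
Hypothesis ef : is_experiment lo hi f.

Lemma integrable_zonoid (F : 'I_n.+1 -> R -> R) : (forall i, is_density mu (F i)) ->
  mu.-integrable setT (EFin \o (fun x => Num.max (\sum_i c i * F i x) 0)).
Proof.
move=> dF; apply: integrable_max; last exact: integrable0.
apply: integrable_sum_EFin => i; apply: integrableZl_EFin.
exact: is_density_integrable.
Qed.

(** The factor [n.+1%:R] cancels the uniform prior, and positive homogeneity of the positive part
    absorbs the mixture density. Tests of this form therefore read off the support function of the
    zonoid. *)
Lemma post_expect_zonoid (h : ('I_n -> R) -> R) :
  (forall p, in_hsimplex p ->
    h p = Num.max (\sum_j fullb p j * (n.+1%:R * c j)) 0) ->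
  post_expect lo hi f uniform_prior h =
  (\int[mu]_x Num.max (\sum_i c i * extend0 lo hi f i x) 0)%:E.
Proof.
move=> hE; have dF := extend0_density ef.
rewrite post_expect_extend0 -integral_Rintegral; last exact: integrable_zonoid.
apply: eq_integral => x _; congr EFin; set F := extend0 lo hi f.
have F0 i : 0 <= F i x by case: (dF i).
have hq := in_hsimplex_uniform.
have qF i : fullb uniform_prior i * F i x * (n.+1%:R * c i) = c i * F i x.
  by rewrite fullb_uniform mulrACA mulVf ?pnatr_eq0// mul1r mulrC.
have [m0|m0] := eqVneq (mixdens F uniform_prior x) 0.
  rewrite m0 mul0r big1 ?maxxx// => i _.
  by rewrite -qF (mixdens0 hq F0 m0) mul0r.
rewrite hE; last exact: posterior_hsimplex.
rewrite maxr_pMr ?mulr0; last exact: mixdens_ge0.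
have := mixdens_ubel (fun _ j => n.+1%:R * c j) 0 hq F0; rewrite /ubel => ->.
by congr Num.max; apply: eq_bigr => i _; rewrite qF.
Qed.
End posterior_part.

Variables (xl xr yl yr : R) (f g : 'I_n.+1 -> R -> R).
Hypothesis ef : is_experiment xl xr f.
Hypothesis eg : is_experiment yl yr g.
Local Notation F := (extend0 xl xr f).
Local Notation G := (extend0 yl yr g).

Lemma LB_dominates_zonoid_le : LB_dominates xl xr f yl yr g -> zonoid_le mu G F.
Proof.
move=> LB c; rewrite -lee_fin.
pose be (j : 'I_n.+1) : R := n.+1%:R * c j.
(* State 0 has mass one minus the others, so its coefficient becomes the shift in [C] and is
   subtracted from the remaining coefficients. *)
pose C (t : R) := Num.max (t + be ord0) 0.
have cC : @convex_function R R^o setT C.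
  move=> t x y _ _; rewrite !(@convRE R) (convRE x y t : conv t x y = _) /unstable.onem.
  have t0 : 0 <= t%:inum by [].
  have t1 : t%:inum <= 1 by [].
  move: (t%:inum) t0 t1 => s t0 t1.
  have h1 : x + be ord0 <= C x by rewrite le_max lexx.
  have h2 : 0 <= C x by rewrite le_max lexx orbT.
  have h3 : y + be ord0 <= C y by rewrite le_max lexx.
  have h4 : 0 <= C y by rewrite le_max lexx orbT.
  have t1' : 0 <= 1 - s by rewrite subr_ge0.
  rewrite {1}/C ge_max; apply/andP; split; last by rewrite addr_ge0// mulr_ge0.
  have := ler_wpM2l t0 h1; have := ler_wpM2l t1' h3; lra.
have := LB uniform_prior in_hsimplex_uniform (fun i => be (lift ord0 i) - be ord0) C cC.
have CE p : C (\sum_i (be (lift ord0 i) - be ord0) * p i) =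
    Num.max (\sum_j fullb p j * (n.+1%:R * c j)) 0.
  rewrite /C; congr Num.max; rewrite big_ord_recl fullb0 -/(be ord0).
  under [X in _ = _ + X]eq_bigr do rewrite fullb_lift -/(be _).
  rewrite mulrBl mul1r mulr_suml -addrA [RHS]addrC -sumrN -big_split /=.
  by rewrite addrC [RHS]addrC; congr (_ + _); apply: eq_bigr => i _; ring.
by rewrite !(@post_expect_zonoid _ _ _ c).
Qed.

(** Only the actions 0 and 1 are used for testing: the value is then the positive part of a linear
    form. Linearity in [a] gives quasi-concavity. *)
Let two_actions (c : 'I_n.+1 -> R) : R -> 'I_n.+1 -> R := fun a j => a * (n.+1%:R * c j).

Let ubel_two c a p :
  ubel (two_actions c) a p = a * \sum_j fullb p j * (n.+1%:R * c j).
Proof. by rewrite /ubel mulr_sumr; apply: eq_bigr => j _; rewrite mulrCA. Qed.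

Let two_actions_dp c : decision_problem [set 0; 1] (two_actions c).
Proof. by left; split; [exact: finite_set2|exists 0; left]. Qed.

Let two_actions_qc c (A : set R) : QCC A (two_actions c).
Proof.
move=> p _ a b d _ _ _ ab bd; rewrite !ubel_two; set L := \sum_j _.
rewrite ge_min; have [L0|/ltW L0] := leP 0 L; apply/orP; [left|right].
  by rewrite ler_wpM2r.
by rewrite ler_wnM2r.
Qed.

Lemma Vbar_zonoid_le :
  (forall (A : set R) (u : R -> 'I_n.+1 -> R),
      decision_problem A u -> QCC A u ->
      forall q : 'I_n -> R, in_hsimplex q ->
      (Vbar yl yr g A u q <= Vbar xl xr f A u q)%E) ->
  zonoid_le mu G F.
Proof.
move=> H c; rewrite -lee_fin.
have := H _ _ (two_actions_dp c) (@two_actions_qc c _) _ in_hsimplex_uniform.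
have VE p : Vval [set 0; 1] (two_actions c) p =
    Num.max (\sum_j fullb p j * (n.+1%:R * c j)) 0.
  rewrite /Vval; set L := \sum_j _.
  have Lub : ubound [set ubel (two_actions c) a p | a in [set 0; 1]] (Num.max L 0).
    move=> _ [a /= [->|->] <-]; rewrite ubel_two -/L.
      by rewrite mul0r le_max lexx orbT.
    by rewrite mul1r le_max lexx.
  apply/eqP; rewrite eq_le; apply/andP; split.
    by apply: ge_sup => //; exists (ubel (two_actions c) 0 p), 0 => //; left.
  rewrite ge_max; apply/andP; split; apply: ub_le_sup; try by exists (Num.max L 0).
    by exists 1; [right|rewrite ubel_two mul1r].
  by exists 0; [left|rewrite ubel_two mul0r].
by rewrite /Vbar !(@post_expect_zonoid _ _ _ c).
Qed.

(** The best reply under [G] to the uniform prior in the two-action problem has the support function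
    of [G] as its average payoff. A strategy under [F] dominating it in every state averages at
    least as much, and at most the support function of [F]. *)
Lemma strategies_zonoid_le :
  (forall (A : set R) (u : R -> 'I_n.+1 -> R),
      decision_problem A u -> QCC A u ->
      forall sigmaG : R.-pker R ~> R, is_strategy yl yr A sigmaG ->
      exists sigmaF : R.-pker R ~> R, is_strategy xl xr A sigmaF /\
        forall i : 'I_n.+1,
          (strat_payoff yl yr g A u sigmaG i <= strat_payoff xl xr f A u sigmaF i)%E) ->
  zonoid_le mu G F.
Proof.
move=> H c.
have dG := extend0_density eg; have dF := extend0_density ef.
have dA := two_actions_dp c.
pose l (i : 'I_n.+1) : R := n.+1%:R^-1.
have hl : simplex l.
  by rewrite (_ : l = fullb uniform_prior);
    [exact/fullb_simplex/in_hsimplex_uniform|apply/funext => i; rewrite fullb_uniform].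
have nz : n.+1%:R != 0 :> R by rewrite pnatr_eq0.
have sE (E : 'I_n.+1 -> R -> R) a x :
    score (two_actions c) (fun i => l i * E i x) a = a * \sum_i c i * E i x.
  rewrite /score mulr_sumr; apply: eq_bigr => i _; rewrite /two_actions /l.
  by field.
have mE (E : 'I_n.+1 -> R -> R) x :
    maxs (score (two_actions c) (fun i => l i * E i x)) 0 [:: 1] =
    Num.max (\sum_i c i * E i x) 0.
  by rewrite /= !sE mul0r mul1r maxC.
have sA : [set` [:: 0; 1]] `<=` [set (0 : R); 1].
  by move=> a /=; rewrite !inE => /orP[]/eqP ->; [left|right].
have mb : measurable_fun setT (best (two_actions c) G l 0 [:: 1]).
  by case: (@bounded_measurable_best _ _ [set 0; 1] (two_actions c) G l 0 [:: 1] dG sA 1 id)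
    => // b [] ->; rewrite ?normr0 ?normr1.
have bA x : [set 0; 1] (best (two_actions c) G l 0 [:: 1] x) by exact: nth_in.
have [|sF [ssF HF]] := H _ _ dA (@two_actions_qc c _) (kdirac mb) _.
  by move=> x _; rewrite /kdirac /= diracE mem_set.
have sGE i x : strat_mean [set 0; 1] (two_actions c) (kdirac mb) i x =
    two_actions c (best (two_actions c) G l 0 [:: 1] x) i.
  rewrite /strat_mean /Rintegral /kdirac integral_dirac.
  - by rewrite diracE (mem_set (bA x))/= mul1r.
  - exact (decision_problem_measurable dA).
  - by apply/measurable_EFinP; exact (decision_problem_measurable_fun i dA).
have := Rintegral_best dA l dG sA.
under [in RHS]eq_Rintegral do rewrite mE.
move=> <-.
(* The two actions form an exact net, so the upper bound on payoffs is applied with error zero. *)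
have net0 (a' : R) : [set 0; 1] a' -> exists2 b, b \in [:: 0; 1] &
    forall i, `|two_actions c a' i - two_actions c b i| <= 0.
  move=> aA; exists a'; last by move=> i; rewrite subrr normr0.
  by rewrite !inE; case: aA => ->; rewrite eqxx ?orbT.
have := strat_payoff_le_maxs dA ef ssF hl (lexx 0) net0.
under [X in _ <= X -> _]eq_Rintegral do rewrite mE.
rewrite subr0; apply: le_trans; apply: ler_sum => i _.
rewrite ler_wpM2l ?invr_ge0//.
have := HF i; rewrite !(strat_payoffE dA) // lee_fin.
by under eq_Rintegral do rewrite sGE.
Qed.

Lemma zonoid_le_post_expect q h : in_hsimplex q -> zonoid_le mu G F ->
  qc_approximable h -> (post_expect yl yr g q h <= post_expect xl xr f q h)%E.
Proof.
move=> hq GF hh; have dF := extend0_density ef; have dG := extend0_density eg.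
rewrite !post_expect_extend0 !integral_Rintegral ?lee_fin.
- exact: zonoid_le_posterior.
- exact: integrable_posterior.
- exact: integrable_posterior.
Qed.
End zonoid_order.

Theorem theorem1 (R : realType) (n : nat) (xl xr yl yr : R)
    (f g : 'I_n.+1 -> R -> R) :
  is_experiment xl xr f -> is_experiment yl yr g ->
  (LB_dominates xl xr f yl yr g <->
   (forall (A : set R) (u : R -> 'I_n.+1 -> R),
      decision_problem A u -> QCC A u ->
      forall q : 'I_n -> R, in_hsimplex q ->
      (Vbar yl yr g A u q <= Vbar xl xr f A u q)%E)) /\
  (LB_dominates xl xr f yl yr g <->
   (forall (A : set R) (u : R -> 'I_n.+1 -> R),
      decision_problem A u -> QCC A u ->
      forall sigmaG : R.-pker R ~> R, is_strategy yl yr A sigmaG ->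
      exists sigmaF : R.-pker R ~> R, is_strategy xl xr A sigmaF /\
        forall i : 'I_n.+1,
          (strat_payoff yl yr g A u sigmaG i <= strat_payoff xl xr f A u sigmaF i)%E)).
Proof.
move=> ef eg; split; split.
- move=> LB A u dA qA q hq; apply: zonoid_le_post_expect => //.
    exact: LB_dominates_zonoid_le LB.
  exact: qc_approximable_Vval.
- move=> H q hq b C cC; apply: zonoid_le_post_expect => //.
    exact: Vbar_zonoid_le H.
  exact: qc_approximable_convex.
- move=> LB A u dA qA sigmaG ssG; apply: strategy_dominance => //.
  exact: LB_dominates_zonoid_le LB.
- move=> H q hq b C cC; apply: zonoid_le_post_expect => //.
    exact: strategies_zonoid_le H.
  exact: qc_approximable_convex.
Qed.
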